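(* Let $(\mathbb A,u_0)$ be a pointed graph of groups and let $A=\pi_1(\mathbb A,u_0)$. (a) Mapping a morphism $\mu\colon(\mathbb B,v_0)\to(\mathbb A,u_0)$ to the subgroup $B=\mu_*(\pi_1(\mathbb B,v_0))\le A$ establishes a bijection between the set of pointed coverings of $(\mathbb A,u_0)$ (taken up to isomorphism in $\mathrm{GrGp}^*$) and the set of subgroups of $A$. (b) Similarly, mapping a morphism $\mu\colon\mathbb B\to\mathbb A$ to the conjugacy class of $\mu_*(\pi_1(\mathbb B,v_0))$ (where $v_0$ is an arbitrary vertex of $\mathsf B$ such that $\mu(v_0)=u_0$) establishes a bijection between the set of coverings of $\mathbb A$ (taken up to isomorphism in $\mathrm{GrGp}$) and the set of conjugacy classes of subgroups of $A$.
   Context: **Conventions.** For group elements, $x^g=g^{-1}xg$ and $\gamma_g(x)=x^g$. A graph $\mathsf A$ has a vertex set $V(\mathsf A)$, an edge set $E(\mathsf A)$, maps $o,t\colon E(\mathsf A)\to V(\mathsf A)$ and a fixed-point-free involution $e\mapsto e^{-1}$ on edges with $t(e^{-1})=o(e)$; graph morphisms preserve this structure. $\mathrm{Star}(v)$ is the set of edges with origin $v$. **Graphs of groups.** A graph of groups $\mathbb A$ consists of a graph $\mathsf A$, vertex groups $A_u$, edge groups $A_e=A_{e^{-1}}$, and monomorphisms $\alpha_e\colon A_e\to A_{o(e)}$, $\omega_e\colon A_e\to A_{t(e)}$ with $\omega_e=\alpha_{e^{-1}}$. It is connected if $\mathsf A$ is. A pointed graph of groups $(\mathbb A,u_0)$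 has a distinguished vertex $u_0$. The underlying graph of $\mathbb B$ is denoted by $\mathsf B$, and so on. **Paths.** An $\mathbb A$-path of length $k$ is a sequence $p=(a_0,e_1,a_1,\dots,e_k,a_k)$ where $(e_1,\dots,e_k)$ is a path in $\mathsf A$, $a_{i-1}\in A_{o(e_i)}$, $a_k\in A_{t(e_k)}$ (for $k=0$: $p=(a)$ with $a$ in a vertex group). Paths are concatenated by multiplying the adjacent group elements; a circuit is a path with equal ends. The congruence $=_{\mathbb A}$ is generated by $(1,e,\omega_e(x),e^{-1},1)=_{\mathbb A}(\alpha_e(x))$, $x\in A_e$. $\pi_1(\mathbb A,u)$ is the group of $=_{\mathbb A}$-classes of circuits at $u$. **Morphisms.** A morphism $\mu\colon\mathbb B\to\mathbb A$ consists of a graph morphism $\mathsf B\to\mathsf A$ (also written $\mu$), monomorphisms $\mu_v\colon B_v\to A_{\mu(v)}$ and $\mu_f\colon B_f\to A_{\mu(f)}$, and, for each edge $f$ of $\mathsf B$, twisting elements $f_\alpha\in A_{\mu(o(f))}$, $f_\omega\in A_{\mu(t(f))}$ with $(f^{-1})_\alpha=f_\omega$ and $(f^{-1})_\omega=f_\alpha$, such that with $e=\mu(f)$, $v=o(f)$, $v'=t(f)$: $\alpha_e\circ\mu_f=\gamma_{f_\alpha}\circ\mu_v\circ\alpha_f$ and $\omega_e\circ\mu_f=\gamma_{f_\omega}\circ\mu_{v'}\circ\omega_f$. It is pointed if it maps basepoint to basepoint. It acts on paths by $\mu(b_0,f_1,b_1,\dots,f_k,b_k)=(\mu(b_0)(f_1)_\alpha,\mu(f_1),(f_1)_\omega^{-1}\mu(b_1)(f_2)_\alpha,\dots,\mu(f_k),(f_k)_\omega^{-1}\mu(b_k))$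 and induces $\mu_*\colon\pi_1(\mathbb B,v)\to\pi_1(\mathbb A,\mu(v))$. Morphisms $\mu\colon\mathbb C\to\mathbb B$, $\nu\colon\mathbb B\to\mathbb A$ compose in the obvious way, the $\alpha$-twisting element of an edge $g$ under $\nu\circ\mu$ being $\nu(g_\alpha)\,\mu(g)_\alpha$. **Immersions and coverings.** $\mu$ is an immersion if (i) for edges $f,f'$ of $\mathsf B$ with common origin $v$ and common image $e$, $f=f'$ if and only if $\mu_v(B_v)f_\alpha\alpha_e(A_e)=\mu_v(B_v)f'_\alpha\alpha_e(A_e)$; and (ii) for every edge $f$ with $v=o(f)$, $e=\mu(f)$: $\alpha_e(\mu_f(B_f))=\mu_v(B_v)^{f_\alpha}\cap\alpha_e(A_e)$. It is a covering if it is an immersion and for each vertex $v$ of $\mathsf B$ the map $\mathrm{Star}(v)\to\bigsqcup_{e\in\mathrm{Star}(\mu(v))}\mu(B_v)\backslash A_{\mu(v)}/\alpha_e(A_e)$, $f\mapsto\mu(B_v)f_\alpha\alpha_{\mu(f)}(A_{\mu(f)})$, is bijective. A pointed covering is a pointed morphism whose underlying morphism is a covering. **Equivalence and categories.** Two morphisms $\mu^1,\mu^2\colon\mathbb B\to\mathbb A$ are $\approx$-equivalent if they agree on the underlying graph and there are elements $a_v\in A_{\mu^1(v)}$ ($v\in V(\mathsf B)$) and $a_f\in A_{\mu^1(f)}$ ($f\in E(\mathsf B)$) with $a_{f^{-1}}=a_f$, $\mu^2_v=\gamma_{a_v}\circ\mu^1_v$, and $a_v=f^1_\alpha\,\alpha_{\mu^1(f)}(a_f)\,(f^2_\alpha)^{-1}$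 whenever $o(f)=v$, where $f^i_\alpha$ is the twisting element for $\mu^i$. Pointed morphisms from a connected $(\mathbb B,v_0)$ are $\sim$-equivalent if moreover one can take $a_{v_0}=1$. $\mathrm{GrGp}$ is the category of graphs of groups with $\approx$-classes of morphisms as arrows; $\mathrm{GrGp}^*$ is the category of pointed graphs of groups with connected underlying graph, with $\sim$-classes of pointed morphisms as arrows. Graphs of groups $\mathbb B$ and $\mathbb C$ are isomorphic in $\mathrm{GrGp}$ if there exist morphisms $\mu\colon\mathbb B\to\mathbb C$ and $\nu\colon\mathbb C\to\mathbb B$ such that $\mu\circ\nu$ and $\nu\circ\mu$ are $\approx$-equivalent to the identity morphisms; isomorphism in $\mathrm{GrGp}^*$ is defined in the same way, with pointed morphisms and $\sim$.
   Formalization: Coverings are taken up to isomorphism over A, i.e. compatible with the maps to A (isomorphic domains alone may give different subgroups), and in (b) both A and the covering graphs of groups B are assumed connected, without which the correspondence is ill-defined or not injective. *)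

(* Defs.v *)
From HB Require Import structures.
From mathcomp Require Import all_boot.
From mathcomp Require Import boolp classical_sets functions.
From Stdlib Require Import Relation_Operators.

Set Implicit Arguments.
Unset Strict Implicit.
Unset Printing Implicit Defensive.

Local Open Scope group_scope.
Local Open Scope quotient_scope.
Local Open Scope classical_set_scope.

Notation "{ 'ghom' G -> H }" := (UMagmaMorphism.type G%type H%type)
  (at level 0, G at level 98, H at level 99, format "{ 'ghom'  G  ->  H }")
  : type_scope.

(* [edge u v] is the set of edges e with o(e) = u and t(e) = v; the edge set of
   the graph is the disjoint union of the [edge u v].  Only loops could be
   fixed by the involution. *)
Record graph := Graph {
  vertex :> Type;
  edge : vertex -> vertex -> Type;
  einv : forall u v, edge u v -> edge v u;
  einvK : forall u v (e : edge u v), einv (einv e) = e;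
  einv_neq : forall u (e : edge u u), einv e <> e }.

Arguments edge {g} u v.
Arguments einv {g u v} e.

Definition star (G : graph) (u : G) := {v : G & edge u v}.

Definition in_star (G : graph) (u v : G) (e : edge u v) : star u :=
  existT _ v e.

Definition connected (G : graph) :=
  inhabited G /\
  forall u v : G, clos_refl_trans G (fun x y => inhabited (edge x y)) u v.

Record graph_morphism (H G : graph) := GraphMorphism {
  gm_vertex :> H -> G;
  gm_edge : forall u v, edge u v -> edge (gm_vertex u) (gm_vertex v);
  gm_inv : forall u v (e : edge u v), gm_edge (einv e) = einv (gm_edge e) }.

Arguments gm_edge {H G} g {u v} e.

Definition graph_id (G : graph) : graph_morphism G G :=
  @GraphMorphism G G id (fun _ _ e => e) (fun _ _ _ => erefl).

Lemma graph_comp_inv (K H G : graph) (g : graph_morphism H G)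
    (h : graph_morphism K H) (u v : K) (e : edge u v) :
  gm_edge g (gm_edge h (einv e)) = einv (gm_edge g (gm_edge h e)).
Proof. by rewrite !gm_inv. Qed.

Definition graph_comp (K H G : graph) (g : graph_morphism H G)
    (h : graph_morphism K H) : graph_morphism K G :=
  @GraphMorphism K G (fun u => g (h u)) (fun _ _ e => gm_edge g (gm_edge h e))
    (@graph_comp_inv K H G g h).

(* The identification A_e = A_{e^-1} is the map [erev e]; read through it, the
   monomorphism omega_e is alpha_{e^-1}.  The law [alpha_erev] says that
   omega_{e^-1} = alpha_e.  As alpha is injective, it makes [erev (einv e)] and
   [erev e] mutually inverse (up to e^-1^-1 = e). *)
Record graph_of_groups := GraphOfGroups {
  ugraph :> graph;
  vgroup : ugraph -> groupType;
  egroup : forall u v : ugraph, edge u v -> groupType;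
  erev : forall (u v : ugraph) (e : edge u v),
    {ghom egroup e -> egroup (einv e)};
  alpha : forall (u v : ugraph) (e : edge u v), {ghom egroup e -> vgroup u};
  alpha_inj : forall (u v : ugraph) (e : edge u v), injective (alpha e);
  alpha_erev : forall (u v : ugraph) (e : edge u v) (x : egroup e),
    alpha (einv (einv e)) (erev (einv e) (erev e x)) = alpha e x }.

Arguments vgroup {g} u.
Arguments egroup {g u v} e.
Arguments erev {g u v} e.
Arguments alpha {g u v} e.

Definition omega (A : graph_of_groups) (u v : A) (e : edge u v) :
    {ghom egroup e -> vgroup v} :=
  alpha (einv e) \o erev e.

(* [PCons a0 e1 (... (PNil ak))] is the path (a0, e1, a1, ..., ek, ak). *)
Inductive apath (A : graph_of_groups) : A -> A -> Type :=
| PNil u of vgroup u : apath u u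
| PCons u v w of vgroup u & @edge A u v & apath v w : apath u w.

Arguments PNil {A u} a.
Arguments PCons {A u v w} a e p.

Section Paths.
Variable A : graph_of_groups.
Implicit Types u v w : A.

Definition pmull u w (a : vgroup u) (p : apath u w) : apath u w :=
  match p in apath u' w' return vgroup u' -> apath u' w' with
  | PNil _ b => fun a => PNil (a * b)
  | PCons _ _ _ b e q => fun a => PCons (a * b) e q
  end a.

Fixpoint pcat u v w (p : apath u v) : apath v w -> apath u w :=
  match p in apath u' v' return apath v' w -> apath u' w with
  | PNil _ a => fun q => pmull a q
  | PCons _ _ _ a e p' => fun q => PCons a e (pcat p' q)
  end.

Fixpoint pinv u v (p : apath u v) : apath v u :=
  match p in apath u' v' return apath v' u' with
  | PNil _ a => PNil a^-1
  | PCons _ _ _ a e p' => pcat (pinv p') (PCons 1 (einv e) (PNil a^-1))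
  end.

Inductive pequiv : forall u v, apath u v -> apath u v -> Prop :=
| pequiv_edge u v (e : edge u v) (x : egroup e) :
    pequiv (PCons 1 e (PCons (omega e x) (einv e) (PNil 1)))
           (PNil (alpha e x))
| pequiv_refl u v (p : apath u v) : pequiv p p
| pequiv_sym u v (p q : apath u v) : pequiv p q -> pequiv q p
| pequiv_trans u v (p q r : apath u v) :
    pequiv p q -> pequiv q r -> pequiv p r
| pequiv_cat u v w (p p' : apath u v) (q q' : apath v w) :
    pequiv p p' -> pequiv q q' -> pequiv (pcat p q) (pcat p' q').

Lemma pmullM u v (a b : vgroup u) (p : apath u v) :
  pmull a (pmull b p) = pmull (a * b) p.
Proof. by case: p a b => [x c|x y z c e p] a b; rewrite /= mulgA. Qed.

Lemma pmull1 u v (p : apath u v) : pmull 1 p = p.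
Proof. by case: p => [x c|x y z c e p]; rewrite /= mul1g. Qed.

Lemma pcat_pmull u v w (a : vgroup u) (p : apath u v) (q : apath v w) :
  pcat (pmull a p) q = pmull a (pcat p q).
Proof. by case: p a q => [x c|x y z c e p] a q //=; rewrite pmullM. Qed.

Lemma pcatA u v w z (p : apath u v) (q : apath v w) (r : apath w z) :
  pcat p (pcat q r) = pcat (pcat p q) r.
Proof.
elim: p q r => [x a|x y t a e p IH] q r /=; last by rewrite IH.
by rewrite pcat_pmull.
Qed.

Lemma pcatp1 u v (p : apath u v) : pcat p (PNil 1) = p.
Proof. by elim: p => [x a|x y t a e p IH] /=; rewrite ?mulg1 ?IH. Qed.

Lemma pequiv_edge1 u v (e : edge u v) :
  pequiv (PCons 1 e (PCons 1 (einv e) (PNil 1))) (PNil 1).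
Proof. by have := pequiv_edge (1 : egroup e); rewrite !gmulf1. Qed.

Lemma pcat_pinvl u v (p : apath u v) : pequiv (pcat (pinv p) p) (PNil 1).
Proof.
elim: p => [x a|x y t a e p IH] /=; first by rewrite mulVg; apply: pequiv_refl.
rewrite -pcatA /= mulVg; apply: pequiv_trans IH; apply: pequiv_cat.
  exact: pequiv_refl.
rewrite -[X in pequiv _ X]pmull1 -[PCons _ _ _]/(PCons 1 (einv e) (PCons 1 e p)).
have := pequiv_cat (pequiv_edge1 (einv e)) (pequiv_refl p).
by rewrite einvK /= pmull1.
Qed.

HB.instance Definition _ u v := gen_eqMixin (apath u v).
HB.instance Definition _ u v := gen_choiceMixin (apath u v).

Section Pi1.
Variable u : A.

Definition pequivb (p q : apath u u) : bool := `[< pequiv p q >].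

Lemma pequivb_refl : reflexive pequivb.
Proof. by move=> p; apply/asboolP/pequiv_refl. Qed.

Lemma pequivb_sym : symmetric pequivb.
Proof. by move=> p q; apply/idP/idP => /asboolP/pequiv_sym/asboolP. Qed.

Lemma pequivb_trans : transitive pequivb.
Proof.
by move=> q p r /asboolP pq /asboolP qr; apply/asboolP/(pequiv_trans pq).
Qed.

Canonical pequiv_rel := EquivRel pequivb pequivb_refl pequivb_sym pequivb_trans.

Definition pi1 := {eq_quot pequiv_rel}.

HB.instance Definition _ := Choice.on pi1.
HB.instance Definition _ := EqQuotient.on pi1.

Lemma pi1P (p q : apath u u) : \pi_pi1 p = \pi_pi1 q <-> pequiv p q.
Proof. by split=> [/eqmodP/asboolP|pq]; last exact/eqmodP/asboolP. Qed.

Lemma repr_pi1 (p : apath u u) : pequiv (repr (\pi_pi1 p)) p.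
Proof. by apply/pi1P; rewrite reprK. Qed.

Definition pi1_mul (x y : pi1) : pi1 := \pi_pi1 (pcat (repr x) (repr y)).
Definition pi1_one : pi1 := \pi_pi1 (PNil 1).
Definition pi1_inv (x : pi1) : pi1 := \pi_pi1 (pinv (repr x)).

Lemma pi1_mul_pi (p q : apath u u) :
  pi1_mul (\pi_pi1 p) (\pi_pi1 q) = \pi_pi1 (pcat p q).
Proof. by apply/pi1P/pequiv_cat; apply: repr_pi1. Qed.

Lemma pi1_mulA : associative pi1_mul.
Proof.
move=> x y z; rewrite -[x]reprK -[y]reprK -[z]reprK.
rewrite (pi1_mul_pi (repr y) (repr z)) (pi1_mul_pi (repr x) (repr y)).
by rewrite !pi1_mul_pi pcatA.
Qed.

Lemma pi1_mul1 : left_id pi1_one pi1_mul.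
Proof. by move=> x; rewrite -[x]reprK pi1_mul_pi /= pmull1. Qed.

Lemma pi1_mulp1 : right_id pi1_one pi1_mul.
Proof. by move=> x; rewrite -[x]reprK pi1_mul_pi pcatp1. Qed.

Lemma pi1_mulV : left_inverse pi1_one pi1_inv pi1_mul.
Proof.
move=> x; rewrite -{2}[x]reprK pi1_mul_pi.
exact/pi1P/pcat_pinvl.
Qed.

Lemma pi1_mulpV : right_inverse pi1_one pi1_inv pi1_mul.
Proof.
move=> x; set y := pi1_inv x; rewrite -[pi1_mul x y]pi1_mul1.
rewrite -{1}(pi1_mulV y) -pi1_mulA [pi1_mul y _]pi1_mulA.
by rewrite {2}/y pi1_mulV pi1_mul1 pi1_mulV.
Qed.

HB.instance Definition _ :=
  isGroup.Build pi1 pi1_mulA pi1_mul1 pi1_mulp1 pi1_mulV pi1_mulpV.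

End Pi1.
End Paths.

Section Morphisms.
Variables B A : graph_of_groups.

(* The data of a morphism over a given morphism of underlying graphs.  The
   twisting elements are f_alpha = [gd_twist f] and f_omega = (f^-1)_alpha.
   That mu_f and mu_{f^-1} agree on B_f = B_{f^-1} follows from [gd_omegaE],
   the law [gd_alphaE] for f^-1 and the injectivity of omega_e. *)
Record gog_data (phi : graph_morphism B A) := GogData {
  gd_v : forall v : B, {ghom vgroup v -> vgroup (phi v)};
  gd_v_inj : forall v : B, injective (gd_v v);
  gd_e : forall (u v : B) (f : edge u v),
    {ghom egroup f -> egroup (gm_edge phi f)};
  gd_e_inj : forall (u v : B) (f : edge u v), injective (gd_e f);
  gd_twist : forall (u v : B) (f : edge u v), vgroup (phi u);
  gd_alphaE : forall (u v : B) (f : edge u v) (x : egroup f),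
    alpha (gm_edge phi f) (gd_e f x) = gd_v u (alpha f x) ^ gd_twist f;
  gd_omegaE : forall (u v : B) (f : edge u v) (x : egroup f),
    omega (gm_edge phi f) (gd_e f x) =
      gd_v v (omega f x) ^ gd_twist (einv f) }.

Record morphism := Morphism {
  mor_graph :> graph_morphism B A;
  mor_data : gog_data mor_graph }.

Variable mu : morphism.

Definition mor_v (v : B) : {ghom vgroup v -> vgroup (mu v)} :=
  gd_v (mor_data mu) v.

Definition mor_edge (u v : B) (f : edge u v) : edge (mu u) (mu v) :=
  gm_edge mu f.

Definition mor_e (u v : B) (f : edge u v) :
    {ghom egroup f -> egroup (mor_edge f)} :=
  gd_e (mor_data mu) f.

Definition tw_alpha (u v : B) (f : edge u v) : vgroup (mu u) :=
  gd_twist (mor_data mu) f.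

Definition tw_omega (u v : B) (f : edge u v) : vgroup (mu v) :=
  tw_alpha (einv f).

Fixpoint mor_path (u v : B) (p : apath u v) : apath (mu u) (mu v) :=
  match p in apath u' v' return apath (mu u') (mu v') with
  | PNil x b => PNil (mor_v x b)
  | PCons x _ _ b f q =>
      PCons (mor_v x b * tw_alpha f) (mor_edge f)
            (pmull (tw_omega f)^-1 (mor_path q))
  end.

Definition mor_pi1 (v : B) (x : pi1 v) : pi1 (mu v) :=
  \pi_(pi1 (mu v)) (mor_path (repr x)).

Lemma mor_path_pmull (u v : B) (b : vgroup u) (p : apath u v) :
  mor_path (pmull b p) = pmull (mor_v u b) (mor_path p).
Proof. by case: p b => [x c|x y z c f p] b; rewrite /= gmulfM ?mulgA. Qed.

Lemma mor_path_cat (u v w : B) (p : apath u v) (q : apath v w) :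
  mor_path (pcat p q) = pcat (mor_path p) (mor_path q).
Proof.
elim: p q => [x b|x y z b f p IH] q /=; first exact: mor_path_pmull.
by rewrite IH pcat_pmull.
Qed.

End Morphisms.

Lemma pequiv_pmull (A : graph_of_groups) (u v : A) (a : vgroup u)
  (p q : apath u v) : pequiv p q -> pequiv (pmull a p) (pmull a q).
Proof. exact: (pequiv_cat (pequiv_refl (PNil a))). Qed.

Lemma pequiv_edgeM (A : graph_of_groups) (u v : A) (e : edge u v)
    (x : egroup e) (a b : vgroup u) :
  pequiv (PCons a e (PCons (omega e x) (einv e) (PNil b)))
         (PNil (a * alpha e x * b)).
Proof.
have := pequiv_cat (pequiv_pmull a (pequiv_edge x)) (pequiv_refl (PNil b)).
by rewrite /= mul1g mulg1.
Qed.

Lemma mor_path_equiv (B A : graph_of_groups) (mu : morphism B A) (u v : B)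
  (p q : apath u v) : pequiv p q -> pequiv (mor_path mu p) (mor_path mu q).
Proof.
elim=> {u v p q}.
- move=> u v f x /=.
  rewrite !gmulf1 !mul1g mulg1 /tw_omega einvK.
  have -> : (tw_alpha mu (einv f))^-1 * (mor_v mu v (omega f x) *
              tw_alpha mu (einv f)) = omega (mor_edge mu f) (mor_e mu f x).
    by rewrite -conjgE -gd_omegaE.
  rewrite [mor_edge mu (einv f)]gm_inv.
  have H := pequiv_edgeM (mor_e mu f x) (tw_alpha mu f) (tw_alpha mu f)^-1.
  apply: pequiv_trans H _.
  rewrite [alpha _ _]gd_alphaE conjgE !mulgA mulgV mul1g mulgK.
  exact: pequiv_refl.
- by move=> u v p; apply: pequiv_refl.
- by move=> u v p q _; apply: pequiv_sym.
- by move=> u v p q r _ pq _; apply: pequiv_trans.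
- by move=> u v w p p' q q' _ pp' _ qq'; rewrite !mor_path_cat; apply: pequiv_cat.
Qed.

Lemma mor_pi1_pi (B A : graph_of_groups) (mu : morphism B A) (v : B)
    (p : apath v v) :
  mor_pi1 mu (\pi_(pi1 v) p) = \pi_(pi1 (mu v)) (mor_path mu p).
Proof. exact/pi1P/mor_path_equiv/repr_pi1. Qed.

Lemma mor_pi1M (B A : graph_of_groups) (mu : morphism B A) (v : B) :
  {morph @mor_pi1 B A mu v : x y / x * y}.
Proof.
move=> x y; rewrite -[x]reprK -[y]reprK [in LHS]/mul /= pi1_mul_pi !mor_pi1_pi.
by rewrite mor_path_cat [RHS]pi1_mul_pi.
Qed.

Section Identity.
Variable A : graph_of_groups.

Lemma id_alphaE (u v : A) (f : edge u v) (x : egroup f) :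
  alpha f x = alpha f x ^ 1.
Proof. by rewrite conjg1. Qed.

Lemma id_omegaE (u v : A) (f : edge u v) (x : egroup f) :
  omega f x = omega f x ^ 1.
Proof. by rewrite conjg1. Qed.

Definition mor_id : morphism A A := @Morphism A A (graph_id A)
  (@GogData A A (graph_id A)
     (fun v => idfun : {ghom vgroup v -> vgroup v}) (fun v => @inj_id _)
     (fun u v f => idfun : {ghom egroup f -> egroup f})
     (fun u v f => @inj_id _) (fun u v f => 1) id_alphaE id_omegaE).

End Identity.

Section Composition.
Variables (C B A : graph_of_groups) (nu : morphism B A) (mu : morphism C B).

Definition comp_v (v : C) : {ghom vgroup v -> vgroup (nu (mu v))} :=
  mor_v nu (mu v) \o mor_v mu v.

Definition comp_e (u v : C) (g : edge u v) :
    {ghom egroup g -> egroup (mor_edge nu (mor_edge mu g))} :=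
  mor_e nu (mor_edge mu g) \o mor_e mu g.

Definition comp_twist (u v : C) (g : edge u v) : vgroup (nu (mu u)) :=
  mor_v nu (mu u) (tw_alpha mu g) * tw_alpha nu (mor_edge mu g).

Lemma comp_v_inj (v : C) : injective (comp_v v).
Proof. exact: inj_comp (@gd_v_inj _ _ _ _ _) (@gd_v_inj _ _ _ _ _). Qed.

Lemma comp_e_inj (u v : C) (g : edge u v) : injective (comp_e g).
Proof. exact: inj_comp (@gd_e_inj _ _ _ _ _ _ _) (@gd_e_inj _ _ _ _ _ _ _). Qed.

Lemma comp_alphaE (u v : C) (g : edge u v) (x : egroup g) :
  alpha (mor_edge nu (mor_edge mu g)) (comp_e g x) =
    comp_v u (alpha g x) ^ comp_twist g.
Proof.
by rewrite [LHS]gd_alphaE [alpha _ _]gd_alphaE gmulfJ -conjgM.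
Qed.

Lemma comp_omegaE (u v : C) (g : edge u v) (x : egroup g) :
  omega (mor_edge nu (mor_edge mu g)) (comp_e g x) =
    comp_v v (omega g x) ^ comp_twist (einv g).
Proof.
rewrite [LHS]gd_omegaE [omega _ _]gd_omegaE gmulfJ -conjgM.
by rewrite /comp_twist [mor_edge mu (einv g)]gm_inv.
Qed.

Definition mor_comp : morphism C A := @Morphism C A (graph_comp nu mu)
  (@GogData C A (graph_comp nu mu) comp_v comp_v_inj comp_e comp_e_inj
     comp_twist comp_alphaE comp_omegaE).

End Composition.

(* mu_*(pi_1(B,v)), transported to pi_1(A,u) along mu(v) = u. *)
Definition pi1_image (B A : graph_of_groups) (mu : morphism B A) (v : B)
    (u : A) (mu_v : mu v = u) : set (pi1 u) :=
  match mu_v in _ = w return set (pi1 w) with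
  | erefl => range (mor_pi1 mu (v := v))
  end.

Definition dcoset (G : groupType) (H : set G) (g : G) (K : set G) : set G :=
  [set h * g * k | h in H & k in K].

Section Coverings.
Variables (B A : graph_of_groups) (mu : morphism B A).

Definition edge_dcoset (v w : B) (f : edge v w) : set (vgroup (mu v)) :=
  dcoset (range (mor_v mu v)) (tw_alpha mu f) (range (alpha (mor_edge mu f))).

Definition immersion : Prop :=
  (forall (v w w' : B) (f : edge v w) (f' : edge v w'),
     in_star (mor_edge mu f) = in_star (mor_edge mu f') ->
     (in_star f = in_star f' <-> edge_dcoset f = edge_dcoset f')) /\
  (forall (v w : B) (f : edge v w),
     [set alpha (mor_edge mu f) y | y in range (mor_e mu f)] =
     [set x ^ tw_alpha mu f | x in range (mor_v mu v)] `&`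
       range (alpha (mor_edge mu f))).

Definition star_dcosets (v : B) : set (star (mu v) * set (vgroup (mu v))) :=
  [set eD | exists a : vgroup (mu v),
     eD.2 = dcoset (range (mor_v mu v)) a (range (alpha (projT2 eD.1)))].

Definition star_map (v : B) (f : star v) :
    star (mu v) * set (vgroup (mu v)) :=
  (in_star (mor_edge mu (projT2 f)), edge_dcoset (projT2 f)).

Definition covering : Prop :=
  immersion /\
  forall v : B, set_bij [set: star v] (@star_dcosets v) (@star_map v).

End Coverings.

Section Equivalence.
Variables B A : graph_of_groups.

Definition data_equiv (phi : graph_morphism B A) (d1 d2 : gog_data phi)
    (a : forall v : B, vgroup (phi v)) : Prop :=
  exists a_e : forall (u v : B) (f : edge u v), egroup (gm_edge phi f),
  [/\ (* a_{f^-1} = a_f; the two elements live over the edges phi(f^-1) and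
         phi(f)^-1, which are equal by [gm_inv] *)
      forall (u v : B) (f : edge u v),
        existT (fun e => egroup e) (gm_edge phi (einv f)) (a_e v u (einv f)) =
        existT (fun e => egroup e) (einv (gm_edge phi f))
          (erev (gm_edge phi f) (a_e u v f)),
      forall (v : B) (b : vgroup v), gd_v d2 v b = gd_v d1 v b ^ a v &
      forall (v w : B) (f : edge v w),
        a v = gd_twist d1 f * alpha (gm_edge phi f) (a_e v w f)
                * (gd_twist d2 f)^-1].

(* Both morphisms have the same underlying graph morphism exactly when mu2 is
   [Morphism d2] for some data [d2] over the graph morphism of mu1. *)
Definition mor_equiv (mu1 mu2 : morphism B A) : Prop :=
  exists (d2 : gog_data mu1) (a : forall v : B, vgroup (mu1 v)),
    mu2 = Morphism d2 /\ data_equiv (mor_data mu1) d2 a.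

Definition pmor_equiv (v0 : B) (mu1 mu2 : morphism B A) : Prop :=
  exists (d2 : gog_data mu1) (a : forall v : B, vgroup (mu1 v)),
    [/\ mu2 = Morphism d2, data_equiv (mor_data mu1) d2 a & a v0 = 1].

End Equivalence.

(* The domain is an object of GrGp*, hence connected. *)
Record pointed_covering (A : graph_of_groups) (u0 : A) := PointedCovering {
  pc_dom : graph_of_groups;
  pc_base : pc_dom;
  pc_connected : connected pc_dom;
  pc_mor : morphism pc_dom A;
  pc_pointed : pc_mor pc_base = u0;
  pc_covering : covering pc_mor }.

(* Isomorphism in GrGp* of objects over (A, u0): the subgroup attached to a
   covering depends on the map to A and not only on its domain. *)
Definition pcov_iso (A : graph_of_groups) (u0 : A)
    (c d : pointed_covering u0) : Prop :=
  exists (phi : morphism (pc_dom c) (pc_dom d))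
         (psi : morphism (pc_dom d) (pc_dom c)),
    (phi (pc_base c) = pc_base d /\ psi (pc_base d) = pc_base c) /\
    [/\ pmor_equiv (pc_base d) (mor_comp phi psi) (mor_id (pc_dom d)),
        pmor_equiv (pc_base c) (mor_comp psi phi) (mor_id (pc_dom c)) &
        pmor_equiv (pc_base c) (mor_comp (pc_mor d) phi) (pc_mor c)].

Definition pcov_subgroup (A : graph_of_groups) (u0 : A)
    (c : pointed_covering u0) : set (pi1 u0) :=
  pi1_image (pc_pointed c).

Record connected_covering (A : graph_of_groups) := ConnectedCovering {
  cc_dom : graph_of_groups;
  cc_connected : connected cc_dom;
  cc_mor : morphism cc_dom A;
  cc_covering : covering cc_mor }.

(* Isomorphism in GrGp of objects over A. *)
Definition cov_iso (A : graph_of_groups) (c d : connected_covering A) : Prop :=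
  exists (phi : morphism (cc_dom c) (cc_dom d))
         (psi : morphism (cc_dom d) (cc_dom c)),
    [/\ mor_equiv (mor_comp phi psi) (mor_id (cc_dom d)),
        mor_equiv (mor_comp psi phi) (mor_id (cc_dom c)) &
        mor_equiv (mor_comp (cc_mor d) phi) (cc_mor c)].

Definition subgroup (G : groupType) (H : set G) : Prop := group_closed (mem H).

Definition conj_class (G : groupType) (H : set G) : set (set G) :=
  [set [set h ^ g | h in H] | g in [set: G]].

Definition subgroup_classes (G : groupType) : set (set (set G)) :=
  [set conj_class H | H in @subgroup G].

(* [cov_class u0 c C]: C is the conjugacy class of mu_*(pi_1(B,v0)) for some
   vertex v0 with mu(v0) = u0, mu : B -> A being the covering c. *)
Definition cov_class (A : graph_of_groups) (u0 : A) (c : connected_covering A)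
    (C : set (set (pi1 u0))) : Prop :=
  exists (v0 : cc_dom c) (mu_v0 : cc_mor c v0 = u0),
    C = conj_class (pi1_image mu_v0).

(* [F] is the graph of a map X -> Y with values in S which induces a bijection
   from the classes of X under R to S. *)
Definition induces_bijection (X Y : Type) (R : X -> X -> Prop) (S : set Y)
    (F : X -> Y -> Prop) : Prop :=
  [/\ forall x, exists! y, F x y,
      forall x y, F x y -> S y,
      forall x x' y y', F x y -> F x' y' -> (R x x' <-> y = y') &
      forall y, S y -> exists x, F x y].

(* Main.v *)
From HB Require Import structures.
From mathcomp Require Import all_boot.
From mathcomp Require Import boolp classical_sets functions.
From Stdlib Require Import Relation_Operators.
Require Import Defs.

(** Coverings are classified by translating them into actions, as for
    topological spaces.  An action of [A] ([graph_action]) is a right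
    [vgroup u]-set [X u] for each vertex [u] together with a bijection
    [ptr e : X u -> X v] for each edge [e], carrying the action of [egroup e]
    through [alpha e] to the one through [omega e].  Paths then act on points,
    and the defining relation of the path congruence acts trivially
    ([pact_pequiv]), so [pi1 u] acts on [X u]; a transitive action is determined
    by the stabiliser of one of its points ([equivariant_iso]), and the right
    cosets of a subgroup [H] give a transitive action with a point stabilised by
    [H] ([coset_stabiliser]).

    A covering [mu : B -> A] yields the action [fiber] on the cosets
    [mu(B_v) a] in [vgroup (mu v)].  A coset crosses the edge [e] along the edge
    [f] of [B] to which the covering condition associates its double coset; the
    two immersion conditions make the outcome well defined
    ([ltr_functional]).  That congruent paths act equally is then the unique
    path lifting property, obtained here without normal forms for paths, and it
    shows that the image of [pi1 v] is the stabiliser of the coset [mu(B_v)]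
    ([pi1_imageE]).

    Conversely a transitive action comes from a covering ([cover_of_action]):
    its vertices and edges are orbits of the vertex and edge groups, its groups
    are the stabilisers of chosen orbit representatives, and the twisting
    elements compare the representatives chosen for edges and for vertices.
    With the coset action, every subgroup is the image of a covering.

    Finally an equivariant map between the fibres of [mu : B -> A] and
    [nu : C -> A] is induced by a morphism [phi : B -> C] such that [nu phi] is
    equivalent to [mu] ([lift_morphism]), and a self-map of a covering inducing
    the identity on the fibre is equivalent to the identity ([equiv_via_id]).
    Hence inverse equivariant bijections give inverse isomorphisms
    ([covering_iso]).  Equal images thus give isomorphic pointed coverings, and
    conjugate images give isomorphic coverings, since moving a point of the
    fibre along a loop conjugates its stabiliser ([stabiliser_pact]).  The other
    implications follow from the effect of equivalent morphisms on paths
    ([equiv_via_path]). *)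

Set Implicit Arguments.
Unset Strict Implicit.
Unset Printing Implicit Defensive.

Local Open Scope group_scope.
Local Open Scope quotient_scope.
Local Open Scope classical_set_scope.

(** * Preliminaries *)

Lemma existT_inj2 (I : Type) (T : I -> Type) (i : I) (x y : T i) :
  existT T i x = existT T i y -> x = y.
Proof.
move=> E; have := projT2_eq E.
by rewrite (Prop_irrelevance (projT1_eq E) erefl).
Qed.

Section Homomorphisms.
Variables (A B : graph_of_groups) (mu : morphism B A).

Lemma omegaM (u v : A) (e : edge u v) : {morph omega e : x y / x * y}.
Proof. exact: gmulfM. Qed.

Lemma omegaV (u v : A) (e : edge u v) : {morph omega e : x / x^-1}.
Proof. exact: gmulfV. Qed.

Lemma alphaM (u v : A) (e : edge u v) : {morph alpha e : x y / x * y}.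
Proof. exact: gmulfM. Qed.

Lemma alphaV (u v : A) (e : edge u v) : {morph alpha e : x / x^-1}.
Proof. exact: gmulfV. Qed.

Lemma alphaJ (u v : A) (e : edge u v) : {morph alpha e : x y / x ^ y}.
Proof. exact: gmulfJ. Qed.

Lemma omegaJ (u v : A) (e : edge u v) : {morph omega e : x y / x ^ y}.
Proof. exact: gmulfJ. Qed.

Lemma omega_erev (u v : A) (e : edge u v) (c : egroup e) :
  omega (einv e) (erev e c) = alpha e c.
Proof. exact: alpha_erev. Qed.

Lemma mor_v1 (v : B) : mor_v mu v 1 = 1.
Proof. exact: gmulf1. Qed.

Lemma mor_vM (v : B) : {morph mor_v mu v : x y / x * y}.
Proof. exact: gmulfM. Qed.

Lemma mor_vV (v : B) : {morph mor_v mu v : x / x^-1}.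
Proof. exact: gmulfV. Qed.

Lemma mor_vJ (v : B) : {morph mor_v mu v : x y / x ^ y}.
Proof. exact: gmulfJ. Qed.

Lemma mor_v_inj (v : B) : injective (mor_v mu v).
Proof. exact: gd_v_inj. Qed.

Lemma mor_e_inj (v w : B) (f : edge v w) : injective (mor_e mu f).
Proof. exact: gd_e_inj. Qed.

Lemma mor_alphaE (v w : B) (f : edge v w) (c : egroup f) :
  alpha (mor_edge mu f) (mor_e mu f c) = mor_v mu v (alpha f c) ^ tw_alpha mu f.
Proof. exact: gd_alphaE. Qed.

Lemma mor_omegaE (v w : B) (f : edge v w) (c : egroup f) :
  omega (mor_edge mu f) (mor_e mu f c) = mor_v mu w (omega f c) ^ tw_omega mu f.
Proof. exact: gd_omegaE. Qed.

End Homomorphisms.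

Section Classes.
Variables (T : Type) (R : T -> T -> Prop).
Hypothesis Rrefl : forall x, R x x.
Hypothesis Rsym : forall x y, R x y -> R y x.
Hypothesis Rtrans : forall x y z, R x y -> R y z -> R x z.

(** The quotient of [T] by [R], for an equivalence on a bare type: a class is
    the set of its members, so equality of classes is extensional. *)
Definition classes := {S : set T | exists x, S = R x}.

Definition cls (x : T) : classes := exist _ (R x) (ex_intro _ x erefl).

Lemma cls_eq x y : cls x = cls y <-> R x y.
Proof.
split=> [E|xy]; first by have := congr1 sval E => /= ->.
apply: eq_exist => /=; apply/seteqP; split=> z /=; first exact/Rtrans/Rsym.
exact: Rtrans.
Qed.

Lemma clsP (q : classes) : exists x, q = cls x.
Proof. by case: q => S [x E]; exists x; apply: eq_exist. Qed.

Definition crepr (q : classes) : T := projT1 (cid (clsP q)).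

Lemma creprK q : cls (crepr q) = q.
Proof. by rewrite /crepr; case: cid => x /= ->. Qed.

End Classes.

(** Two double cosets coincide as soon as they meet, hence exactly when a
    representative of one lies in the other. *)
Lemma dcoset_eq (G1 G2 G : groupType) (h : {ghom G1 -> G}) (k : {ghom G2 -> G})
    (g g' : G) :
  dcoset (range h) g (range k) = dcoset (range h) g' (range k) <->
  exists b c, g' = h b * g * k c.
Proof.
split=> [E|[b [c ->]]].
  have : dcoset (range h) g' (range k) g'.
    exists 1; first by exists 1; rewrite ?gmulf1.
    exists 1; first by exists 1; rewrite ?gmulf1.
    by rewrite mul1g mulg1.
  by rewrite -E => -[_ [b _ <-] [_ [c _ <-] <-]]; exists b, c.
apply/seteqP; split=> _ [_ [b' _ <-] [_ [c' _ <-] <-]].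
  exists (h (b' * b^-1)); first by exists (b' * b^-1).
  exists (k (c^-1 * c')); first by exists (c^-1 * c').
  by rewrite !gmulfM !gmulfV !mulgA mulgVK mulgK.
exists (h (b' * b)); first by exists (b' * b).
exists (k (c * c')); first by exists (c * c').
by rewrite !gmulfM !mulgA.
Qed.

Section SubgroupType.
Variables (G : groupType) (S : set G) (subS : subgroup S).

(** The proof of [subgroup S] is a parameter so that the group structure can
    be inferred from the type alone. *)
Definition sgroup of subgroup S := {x : G | x \in S}.
HB.instance Definition _ := SubChoice.on (sgroup subS).
HB.instance Definition _ :=
  SubChoice_isSubGroup.Build G (mem S) (sgroup subS) subS.

Definition sgval : {ghom sgroup subS -> G} := val.

Lemma sgval_inj : injective sgval.
Proof. exact: val_inj. Qed.

Lemma sgvalP (x : sgroup subS) : S (sgval x).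
Proof. by have := valP x; rewrite inE. Qed.

Definition sgSub (x : G) (Sx : S x) : sgroup subS := exist _ x (mem_set Sx).

End SubgroupType.

Arguments sgval {G S subS}.
Arguments sgval_inj {G S subS}.

Section GroupMorphism.
Variables (G H : groupType) (f : G -> H) (fM : {morph f : x y / x * y}).

(** An alias of [f] that mentions the proof [fM], so that the structure of
    morphism can be attached to it. *)
Definition ghom_fun of {morph f : x y / x * y} := f.

Lemma ghom_funF : {morph ghom_fun fM : x y / x / y}.
Proof. 
move=> x y; apply: (mulIg (f y)).
by rewrite /ghom_fun -fM !mulgVK.
Qed.

HB.instance Definition _ := isGroupMorphism.Build G H (ghom_fun fM) ghom_funF.

Definition mk_ghom : {ghom G -> H} := ghom_fun fM.

End GroupMorphism.

(** The fibres of an injective [i] being singletons, the choice of preimages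
    is forced, and compatible with products. *)
Lemma ghom_choice (G H K : groupType) (i : {ghom H -> K}) (f : G -> K) :
  injective i -> {morph f : x y / x * y} -> (forall x, exists y, i y = f x) ->
  exists g : {ghom G -> H}, forall x, i (g x) = f x.
Proof.
move=> i_inj fM i_ex; pose g x := projT1 (cid (i_ex x)).
have gE x : i (g x) = f x by rewrite /g; case: cid.
have gM : {morph g : x y / x * y}.
  by move=> x y; apply: i_inj; rewrite gmulfM !gE fM.
by exists (mk_ghom gM) => x; rewrite -gE.
Qed.

(** * Choices compatible with the inversion of edges *)

Section SymmetricChoice.
Variables (G : graph) (T : G -> Type).
Variable P : forall u v : G, edge u v -> T u -> T v -> Prop.
Hypothesis P_ex : forall (u v : G) (e : edge u v), exists t t', P e t t'.
Hypothesis P_sym : forall (u v : G) (e : edge u v) t t',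
  P e t t' -> P (einv e) t' t.

Let tot (u v : G) (e : edge u v) : {w : G * G & edge w.1 w.2} :=
  existT (fun w : G * G => edge w.1 w.2) (u, v) e.

Lemma tot_einv (u v : G) (e : edge u v) : tot (einv e) <> tot e.
Proof.
move=> E; have vu : v = u := congr1 (fun s => (projT1 s).1) E.
by subst v; have /einv_neq := existT_inj2 E.
Qed.

(** Since no edge equals its inverse, choosing one element in each set [{e,
    e^-1}] orients every edge. *)
Lemma orientation : exists pos : forall u v : G, edge u v -> bool,
  forall (u v : G) (e : edge u v), pos v u (einv e) = ~~ pos u v e.
Proof.
pose pair (u v : G) (e : edge u v) := [set tot e; tot (einv e)].
have pair_ex u v e : exists s, @pair u v e s by exists (tot e); left.
pose pick u v e := projT1 (cid (pair_ex u v e)).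
have pick_einv u v (e : edge u v) : pick v u (einv e) = pick u v e.
  have E : pair _ _ (einv e) = pair _ _ e by rewrite /pair einvK setUC.
  rewrite /pick; move: (pair_ex _ _ (einv e)) (pair_ex _ _ e).
  rewrite E => h h'; by rewrite (Prop_irrelevance h h').
exists (fun u v e => `[< pick u v e = tot e >]) => u v e; rewrite pick_einv.
have [E|E] : pair u v e (pick u v e) by rewrite /pick; case: cid.
  by rewrite E; case: asboolP => [/esym/tot_einv|_]; case: asboolP.
by rewrite E; case: asboolP => // _; case: asboolP => // /tot_einv.
Qed.

(** Data at the two ends of an edge have to be chosen as a pair, yet the data
    of [e^-1] are those of [e] exchanged. Choosing a pair for the positive
    edges only and exchanging it for the others meets both demands. *)
Lemma symmetric_choice : exists s : forall u v : G, edge u v -> T u,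
  forall (u v : G) (e : edge u v), P e (s u v e) (s v u (einv e)).
Proof.
have [pos posV] := orientation.
have [t tP] : exists t : forall u v, edge u v -> T u * T v,
    forall u v e, P e (t u v e).1 (t u v e).2.
  pose h u v e := cid (@P_ex u v e); pose h' u v e := cid (projT2 (h u v e)).
  exists (fun u v e => (projT1 (h u v e), projT1 (h' u v e))) => u v e.
  exact: projT2 (h' u v e).
exists (fun u v e => if pos u v e then (t u v e).1 else (t v u (einv e)).2).
move=> u v e; rewrite posV; case: (pos u v e) => /=; first by rewrite einvK.
by have /P_sym := tP v u (einv e); rewrite einvK.
Qed.

End SymmetricChoice.

(** * Congruence of paths *)

Lemma connected_apath (A : graph_of_groups) :
  connected A -> forall u v : A, inhabited (apath u v).
Proof.
move=> [_ conn] u v.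
elim: (conn u v) => {u v} [x y [e]|x|x y z _ [p] _ [q]]; split.
- exact: PCons 1 e (PNil 1).
- exact: PNil 1.
- exact: pcat p q.
Qed.

(** In a monoid-like structure where every element has a left inverse, left
    inverses are also right inverses: [p q] is congruent to [q' q p q] with
    [q' q] trivial, where [q] inverts [p] and [q'] inverts [q]. *)
Lemma pcat_pinvr (A : graph_of_groups) (u v : A) (p : apath u v) :
  pequiv (pcat p (pinv p)) (PNil 1).
Proof.
set q := pinv p.
have E1 := pcat_pinvl q; have E2 := pcat_pinvl p; rewrite -/q in E2.
apply: pequiv_trans (E1); apply: pequiv_sym.
have -> : pcat (pinv q) q = pcat (pinv q) (pcat (PNil 1) q).
  by rewrite /= pmull1.
apply: pequiv_trans (pequiv_cat (pequiv_refl (pinv q))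
  (pequiv_cat (pequiv_sym E2) (pequiv_refl q))) _.
rewrite -pcatA pcatA -{2}[pcat p q]pmull1.
exact: (pequiv_cat E1 (pequiv_refl (pcat p q))).
Qed.

Lemma pequiv_back (A : graph_of_groups) (u v w : A) (e : edge u v)
    (p : apath v w) : pequiv (PCons 1 (einv e) (PCons 1 e p)) p.
Proof.
have := pequiv_cat (pequiv_edge1 (einv e)) (pequiv_refl p).
by rewrite /= einvK !pmull1.
Qed.

Lemma pequiv_cons (A : graph_of_groups) (u v w : A) (a : vgroup u)
    (e : edge u v) (p q : apath v w) :
  pequiv p q -> pequiv (PCons a e p) (PCons a e q).
Proof.
move=> pq; have := pequiv_cat (pequiv_refl (PCons a e (PNil 1))) pq.
by rewrite /= !pmull1.
Qed.

(** The defining relation in its most useful form: an element of the edge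
    group passes from one side of the edge to the other. *)
Lemma pequiv_slide (A : graph_of_groups) (u v w : A) (e : edge u v)
    (a : vgroup u) (c : egroup e) (p : apath v w) :
  pequiv (PCons (a * alpha e c) e p) (PCons a e (pmull (omega e c) p)).
Proof.
have H := pequiv_cat (pequiv_pmull a (pequiv_edge c))
  (pequiv_refl (PCons 1 e p)).
rewrite /= !mulg1 in H; apply: pequiv_trans (pequiv_sym H) _.
have := pequiv_cat (pequiv_refl (PCons a e (PNil (omega e c))))
  (pequiv_back e p).
by rewrite /= mulg1.
Qed.

(** * Actions of a graph of groups and of its paths *)

(** Equivalently, a right action of the fundamental groupoid of [A]; a
    covering space of [A] is determined by the action on its fibres. *)
Record graph_action (A : graph_of_groups) := GraphAction {
  pt :> A -> Type;
  pmul : forall u : A, pt u -> vgroup u -> pt u;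
  ptr : forall u v : A, edge u v -> pt u -> pt v;
  pmul1 : forall (u : A) (x : pt u), pmul x 1 = x;
  pmulM : forall (u : A) (x : pt u) (a b : vgroup u),
    pmul x (a * b) = pmul (pmul x a) b;
  ptrK : forall (u v : A) (e : edge u v) (x : pt u), ptr (einv e) (ptr e x) = x;
  ptr_alpha : forall (u v : A) (e : edge u v) (x : pt u) (c : egroup e),
    ptr e (pmul x (alpha e c)) = pmul (ptr e x) (omega e c) }.

Arguments pmul {A X u} x a : rename.
Arguments ptr {A X u v} e x : rename.
(* Keeps simplification from unfolding the concrete actions defined below. *)
Arguments pt : simpl never.
Arguments pmul : simpl never.
Arguments ptr : simpl never.

Section ActionOfPaths.
Variables (A : graph_of_groups) (X : graph_action A).

Fixpoint pact (u v : A) (x : X u) (p : apath u v) : X v :=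
  match p in apath u' v' return X u' -> X v' with
  | PNil _ a => fun x => pmul x a
  | PCons _ _ _ a e q => fun x => pact (ptr e (pmul x a)) q
  end x.

Lemma pact_pmull (u v : A) (x : X u) a (p : apath u v) :
  pact x (pmull a p) = pact (pmul x a) p.
Proof. by case: p a x => [w b|w w' w'' b e p] a x /=; rewrite pmulM. Qed.

Lemma pact_cat (u v w : A) (x : X u) (p : apath u v) (q : apath v w) :
  pact x (pcat p q) = pact (pact x p) q.
Proof.
elim: p x q => [u' a|u' v' w' a e p IH] x q /=; first exact: pact_pmull.
exact: IH.
Qed.

(** The defining relation reads [ptr (einv e)] of [ptr e x . omega e c], and
    [ptr_alpha] moves [c] back across the edge. *)
Lemma pact_pequiv (u v : A) (p q : apath u v) : pequiv p q ->
  forall x : X u, pact x p = pact x q.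
Proof.
elim=> {u v p q}.
- by move=> u v e c x /=; rewrite !pmul1 -ptr_alpha ptrK.
- by [].
- by move=> u v p q _ IH x.
- by move=> u v p q r _ IH _ IH' x; rewrite IH.
- by move=> u v w p p' q q' _ IH _ IH' x; rewrite !pact_cat IH.
Qed.

Lemma pact_pinvK (u v : A) (p : apath u v) (x : X u) :
  pact (pact x p) (pinv p) = x.
Proof. by rewrite -pact_cat (pact_pequiv (pcat_pinvr p)) /= pmul1. Qed.

Definition stabiliser (u : A) (x : X u) : set (pi1 u) :=
  [set g | pact x (repr g) = x].

Lemma stabiliser_pi (u : A) (x : X u) (p : apath u u) :
  stabiliser x (\pi_(pi1 u) p) <-> pact x p = x.
Proof. by rewrite /stabiliser /= (pact_pequiv (repr_pi1 p)). Qed.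

(** Transitivity of the action of paths, based at [x]; it forces [X v] to be
    empty where no path from [u] to [v] exists. *)
Definition transitive_from (u : A) (x : X u) : Prop :=
  forall (v : A) (y : X v), exists p : apath u v, y = pact x p.

End ActionOfPaths.

Section Pi1Paths.
Variables (A : graph_of_groups) (u : A).

Lemma pi1_piM (p q : apath u u) :
  \pi_(pi1 u) (pcat p q) = \pi_(pi1 u) p * \pi_(pi1 u) q.
Proof. exact/esym/pi1_mul_pi. Qed.

Lemma pi1_pi1 : \pi_(pi1 u) (PNil 1) = 1 :> pi1 u.
Proof. by []. Qed.

Lemma pi1_piV (p : apath u u) : \pi_(pi1 u) (pinv p) = (\pi_(pi1 u) p)^-1.
Proof.
apply/esym/mulg1_eq; rewrite -pi1_piM -pi1_pi1.
exact/pi1P/pcat_pinvr.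
Qed.

Variable X : graph_action A.

Lemma stabiliser_subgroup (x : X u) : subgroup (stabiliser x).
Proof.
split=> [|g h]; rewrite ?inE; first by apply/stabiliser_pi; rewrite /= pmul1.
rewrite -[g]reprK -[h]reprK -pi1_piV -pi1_piM => /stabiliser_pi Eg.
move=> /stabiliser_pi Eh; apply/stabiliser_pi.
by rewrite pact_cat Eg -[in LHS]Eh pact_pinvK.
Qed.

(** Transporting a point along [p] conjugates its stabiliser by [p]: this is
    why forgetting base points leaves only conjugacy classes of subgroups. *)
Lemma stabiliser_pact (x : X u) (p : apath u u) :
  stabiliser (pact x p) = [set h ^ \pi_(pi1 u) p | h in stabiliser x].
Proof.
apply/seteqP; split=> [g|_ [h Eh <-]].
  rewrite -[g]reprK => /stabiliser_pi; move: (repr g) => q Eq.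
  exists (\pi_(pi1 u) q ^ (\pi_(pi1 u) p)^-1); last exact: conjgKV.
  rewrite conjgE invgK -pi1_piV -(pi1_piM q) -(pi1_piM p); apply/stabiliser_pi.
  by rewrite !pact_cat Eq pact_pinvK.
move: Eh; rewrite -[h]reprK => /stabiliser_pi; move: (repr h) => q Eq.
rewrite conjgE -pi1_piV -(pi1_piM q) -(pi1_piM (pinv p)); apply/stabiliser_pi.
by rewrite !pact_cat pact_pinvK Eq.
Qed.

End Pi1Paths.

Section Equivariant.
Variables (A : graph_of_groups) (X Y : graph_action A).

Definition equivariant (F : forall u : A, X u -> Y u) : Prop :=
  (forall (u : A) (x : X u) a, F u (pmul x a) = pmul (F u x) a) /\
  (forall (u v : A) (e : edge u v) (x : X u), F v (ptr e x) = ptr e (F u x)).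

Lemma equivariant_pact (F : forall u : A, X u -> Y u) : equivariant F ->
  forall (u v : A) (p : apath u v) (x : X u), F v (pact x p) = pact (F u x) p.
Proof.
move=> [Fmul Ftr] u v; elim=> {u v} [u a|u v w a e p IH] x /=.
  exact: Fmul.
by rewrite IH Ftr Fmul.
Qed.

Lemma equivariant_stabiliser (F : forall u : A, X u -> Y u) (u : A) (x : X u) :
  equivariant F -> stabiliser x `<=` stabiliser (F u x).
Proof.
by move=> Feq g E; rewrite /stabiliser /= -(equivariant_pact Feq) [pact _ _]E.
Qed.

(** The orbit map: [pact x p] can only be sent to [pact y p], and this is
    consistent because [x] is fixed by fewer loops than [y]. *)
Lemma equivariant_extension (u : A) (x : X u) (y : Y u) :
  transitive_from x -> stabiliser x `<=` stabiliser y ->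
  exists F, equivariant F /\ F u x = y.
Proof.
move=> trans sub.
have uniq v (p q : apath u v) : pact x p = pact x q -> pact y p = pact y q.
  move=> E.
  have /stabiliser_pi/sub/stabiliser_pi Ey : pact x (pcat p (pinv q)) = x.
    by rewrite pact_cat E pact_pinvK.
  rewrite -[in RHS]Ey pact_cat -[RHS]pact_cat.
  by rewrite (pact_pequiv (pcat_pinvl q)) /= pmul1.
pose F v (z : X v) : Y v := pact y (projT1 (cid (trans v z))).
have FE v (p : apath u v) : F v (pact x p) = pact y p.
  by rewrite /F; case: cid => q /= /uniq.
exists F; split; last by have := FE u (PNil 1); rewrite /= !pmul1.
split=> [v z a|v w e z]; have [p ->] := trans v z.
  by have := FE v (pcat p (PNil a)); rewrite !pact_cat /= FE.
by have := FE w (pcat p (PCons 1 e (PNil 1))); rewrite !pact_cat /= !pmul1 FE.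
Qed.

End Equivariant.

Lemma equivariant_iso (A : graph_of_groups) (X Y : graph_action A) (u : A)
    (x : X u) (y : Y u) :
  transitive_from x -> transitive_from y -> stabiliser x = stabiliser y ->
  exists F G,
  [/\ equivariant (X := X) (Y := Y) F, equivariant (X := Y) (Y := X) G,
    forall (v : A) (z : X v), G v (F v z) = z,
    forall (v : A) (z : Y v), F v (G v z) = z & F u x = y].
Proof.
move=> tx ty E; have [F [Feq Fx]] : exists F, equivariant F /\ F u x = y.
  by apply: equivariant_extension => //; rewrite E.
have [G [Geq Gy]] : exists G, equivariant G /\ G u y = x.
  by apply: equivariant_extension => //; rewrite E.
exists F, G; split=> // v z.
  have [p ->] := tx v z.
  by rewrite (equivariant_pact Feq) Fx (equivariant_pact Geq) Gy.
have [p ->] := ty v z.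
by rewrite (equivariant_pact Geq) Gy (equivariant_pact Feq) Fx.
Qed.

(** * The action on the cosets of a subgroup of the fundamental group *)

Section Cosets.
Variables (A : graph_of_groups) (u0 : A) (H : set (pi1 u0)).
Hypothesis subH : subgroup H.

(** Paths from [u0] up to left multiplication by loops in [H]: the points of
    the covering with group [H] over [u], seen as a quotient of the universal
    covering. *)
Definition coset_sim (u : A) (p q : apath u0 u) : Prop :=
  exists h : apath u0 u0, H (\pi_(pi1 u0) h) /\ pequiv q (pcat h p).

Lemma coset_sim_refl (u : A) (p : apath u0 u) : coset_sim p p.
Proof.
exists (PNil 1); rewrite /= pmull1; split; last exact: pequiv_refl.
by case: subH => + _; rewrite inE.
Qed.

Lemma coset_sim_sym (u : A) (p q : apath u0 u) : coset_sim p q -> coset_sim q p.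
Proof.
move=> [h [Hh pq]]; exists (pinv h); split.
  rewrite pi1_piV; have /group_closedV := subH.
  by move/(_ (\pi_(pi1 u0) h)); rewrite !inE; apply.
have := pequiv_cat (pequiv_refl (pinv h)) pq; rewrite pcatA => /pequiv_sym.
apply: pequiv_trans.
have := pequiv_cat (pequiv_sym (pcat_pinvl h)) (pequiv_refl p).
by rewrite /= pmull1.
Qed.

Lemma coset_sim_trans (u : A) (p q r : apath u0 u) :
  coset_sim p q -> coset_sim q r -> coset_sim p r.
Proof.
move=> [h [Hh pq]] [k [Hk qr]]; exists (pcat k h); split.
  rewrite pi1_piM; have /group_closedM := subH.
  by move/(_ (\pi_(pi1 u0) k) (\pi_(pi1 u0) h)); rewrite !inE; apply.
rewrite -pcatA; apply: pequiv_trans qr _; apply: pequiv_cat pq.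
exact: pequiv_refl.
Qed.

Definition coset_pt (u : A) : Type := classes (@coset_sim u).
Definition ccls (u : A) : apath u0 u -> coset_pt u := cls (@coset_sim u).

Lemma ccls_eq (u : A) (p q : apath u0 u) : ccls p = ccls q <-> coset_sim p q.
Proof.
apply: cls_eq; [exact: coset_sim_refl|exact: coset_sim_sym|].
exact: coset_sim_trans.
Qed.

Lemma ccls_pequiv (u : A) (p q : apath u0 u) : pequiv p q -> ccls p = ccls q.
Proof.
move=> pq; apply/ccls_eq; have [h [Hh ph]] := coset_sim_refl p.
by exists h; split=> //; apply: pequiv_trans (pequiv_sym pq) ph.
Qed.

Definition coset_cat (u v : A) (x : coset_pt u) (q : apath u v) : coset_pt v :=
  ccls (pcat (crepr x) q).

Lemma coset_cat_cls (u v : A) (p : apath u0 u) (q : apath u v) :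
  coset_cat (ccls p) q = ccls (pcat p q).
Proof.
have [h [Hh ph]] : coset_sim (crepr (ccls p)) p.
  by apply/ccls_eq; apply: creprK.
apply/ccls_eq; exists h; split=> //; rewrite pcatA; apply: pequiv_cat ph _.
exact: pequiv_refl.
Qed.

Lemma coset_catM (u v w : A) (x : coset_pt u) (p : apath u v) (q : apath v w) :
  coset_cat x (pcat p q) = coset_cat (coset_cat x p) q.
Proof. by rewrite -[x]creprK -/(ccls _) !coset_cat_cls pcatA. Qed.

Lemma coset_cat_pequiv (u v : A) (x : coset_pt u) (p q : apath u v) :
  pequiv p q -> coset_cat x p = coset_cat x q.
Proof.
by move=> pq; apply/ccls_pequiv/pequiv_cat => //; apply: pequiv_refl.
Qed.

Lemma coset_cat1 (u : A) (x : coset_pt u) : coset_cat x (PNil 1) = x.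
Proof. by rewrite -[x]creprK -/(ccls _) coset_cat_cls pcatp1. Qed.

Definition coset_mul (u : A) (x : coset_pt u) (a : vgroup u) : coset_pt u :=
  coset_cat x (PNil a).

Definition coset_tr (u v : A) (e : edge u v) (x : coset_pt u) : coset_pt v :=
  coset_cat x (PCons 1 e (PNil 1)).

Lemma coset_mulM (u : A) (x : coset_pt u) (a b : vgroup u) :
  coset_mul x (a * b) = coset_mul (coset_mul x a) b.
Proof. by rewrite /coset_mul -coset_catM. Qed.

Lemma coset_trK (u v : A) (e : edge u v) (x : coset_pt u) :
  coset_tr (einv e) (coset_tr e x) = x.
Proof.
rewrite /coset_tr -coset_catM /= mulg1 -[RHS]coset_cat1.
exact/coset_cat_pequiv/pequiv_edge1.
Qed.

Lemma coset_tr_alpha (u v : A) (e : edge u v) (x : coset_pt u) (c : egroup e) :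
  coset_tr e (coset_mul x (alpha e c)) = coset_mul (coset_tr e x) (omega e c).
Proof.
rewrite /coset_tr /coset_mul -!coset_catM /= mulg1 mul1g.
have := coset_cat_pequiv x (pequiv_slide 1 c (PNil 1)).
by rewrite /= mul1g mulg1.
Qed.

Definition coset_action : graph_action A :=
  GraphAction coset_cat1 coset_mulM coset_trK coset_tr_alpha.

Definition coset_base : coset_action u0 := ccls (PNil 1).

Lemma pact_coset (u v : A) (p : apath u v) (x : coset_action u) :
  pact x p = coset_cat x p.
Proof.
elim: p x => [u1 a|u1 u2 u3 a e p IH] x //=; rewrite IH.
rewrite [pmul _ _]/(coset_mul _ _) [ptr _ _]/(coset_tr _ _).
by rewrite /coset_tr /coset_mul -!coset_catM /= mulg1 pmull1.
Qed.

Lemma coset_transitive : transitive_from coset_base.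
Proof.
move=> u x; exists (crepr x).
by rewrite pact_coset [RHS]coset_cat_cls /= pmull1 [RHS]creprK.
Qed.

Lemma coset_stabiliser : stabiliser coset_base = H.
Proof.
apply/seteqP; split=> g; rewrite -[g]reprK; move: (repr g) => {g} p.
  move/stabiliser_pi; rewrite pact_coset coset_cat_cls /= pmull1.
  by move=> /esym/ccls_eq [h [Hh /pi1P ->]]; rewrite pcatp1.
move=> Hp; apply/stabiliser_pi; rewrite pact_coset coset_cat_cls /= pmull1.
by apply/esym/ccls_eq; exists p; rewrite pcatp1; split=> //; apply: pequiv_refl.
Qed.

End Cosets.

(** * The fibre action of a covering *)

Section LiftedPoints.
Variables (B A : graph_of_groups) (mu : morphism B A).

(** A point [LPt v a] over [u = mu v] stands for the coset [mu(B_v) a]. The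
    index [u] makes the equation [mu v = u] part of the type, which avoids
    transports along it. *)
Inductive lpt : A -> Type := LPt (v : B) (a : vgroup (mu v)) : lpt (mu v).

Definition lpt_vert (u : A) (x : lpt u) : B := let: LPt v _ := x in v.

Definition lpt_mul (u : A) (x : lpt u) : vgroup u -> lpt u :=
  match x in lpt u' return vgroup u' -> lpt u' with
  | LPt v a => fun b => LPt (a * b)
  end.

Definition lpt_lmul (u : A) (x : lpt u) : vgroup (lpt_vert x) -> lpt u :=
  match x as x' in lpt u' return vgroup (lpt_vert x') -> lpt u' with
  | LPt v a => fun b => LPt (mor_v mu v b * a)
  end.

Definition lpt_sim (u : A) (x y : lpt u) : Prop :=
  exists b, y = @lpt_lmul u x b.

Lemma LPt_inj (v : B) (a b : vgroup (mu v)) : LPt a = LPt b -> a = b.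
Proof.
pose tot u (x : lpt u) : {v : B & vgroup (mu v)} :=
  let: LPt v a := x in existT (fun v => vgroup (mu v)) v a.
by move=> E; apply: existT_inj2 (congr1 (@tot _) E).
Qed.

Lemma lpt_simE (v : B) (a b : vgroup (mu v)) :
  lpt_sim (LPt a) (LPt b) <-> exists c, b = mor_v mu v c * a.
Proof. by split=> [[c /LPt_inj ->]|[c ->]]; exists c. Qed.

Lemma lpt_sim_refl (u : A) (x : lpt u) : lpt_sim x x.
Proof. by exists 1; case: x => v a /=; rewrite gmulf1 mul1g. Qed.

Lemma lpt_sim_sym (u : A) (x y : lpt u) : lpt_sim x y -> lpt_sim y x.
Proof.
move=> [b ->]; case: x b => v a b; apply/lpt_simE.
by exists b^-1; rewrite mulgA -gmulfM mulVg gmulf1 mul1g.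
Qed.

Lemma lpt_sim_trans (u : A) (x y z : lpt u) :
  lpt_sim x y -> lpt_sim y z -> lpt_sim x z.
Proof.
move=> [b ->] [c ->]; case: x b c => v a b c; apply/lpt_simE.
by exists (c * b); rewrite gmulfM mulgA.
Qed.

Lemma lpt_sim_mul (u : A) (x y : lpt u) a :
  lpt_sim x y -> lpt_sim (lpt_mul x a) (lpt_mul y a).
Proof.
move=> [b ->]; case: x b a => v a b c; apply/lpt_simE; exists b.
by rewrite mulgA.
Qed.

(** The coset [mu(B_v) a] crosses [e = mu f] when [a] lies in the double
    coset of [f]: if [a = mu(b) f_alpha alpha_e(c)], the path [a e] is
    congruent to [mu(b) f_alpha e omega_e(c)], in which [f_alpha e] is the
    image of [f] followed by [f_omega]. The factor [b'] records that the
    result matters only as a coset. *)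
Inductive ltr : forall u w : A, edge u w -> lpt u -> lpt w -> Prop :=
| Ltr v w (f : edge v w) b b' (c : egroup (mor_edge mu f)) :
    ltr (mor_edge mu f)
      (LPt (mor_v mu v b * (tw_alpha mu f * alpha (mor_edge mu f) c)))
      (LPt (mor_v mu w b' * (tw_omega mu f * omega (mor_edge mu f) c))).

(** The inverse edge [f^-1] exchanges [f_alpha] with [f_omega] and [alpha]
    with [omega], so the relation is symmetric by construction. *)
Lemma ltr_inv (u u' : A) (e : edge u u') (x : lpt u) (y : lpt u') :
  ltr e x y -> ltr (einv e) y x.
Proof.
case=> v w f b b' c.
suff H : forall e' (Ee : mor_edge mu (einv f) = e') (d : egroup e'),
    ltr e' (LPt (mor_v mu w b' * (tw_omega mu f * alpha e' d)))
          (LPt (mor_v mu v b * (tw_alpha mu f * omega e' d))).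
  have := H _ (gm_inv mu f) (erev (mor_edge mu f) c).
  by rewrite /omega /= [gm_edge _ _]/(mor_edge mu f) alpha_erev.
move=> e' <- d.
have -> : tw_alpha mu f = tw_omega mu (einv f) by rewrite /tw_omega einvK.
exact: Ltr.
Qed.

Lemma ltr_alpha (u u' : A) (e : edge u u') (x : lpt u) (y : lpt u')
    (c : egroup e) :
  ltr e x y -> ltr e (lpt_mul x (alpha e c)) (lpt_mul y (omega e c)).
Proof.
move=> H; case: H c => v w f b b' c d /=.
by rewrite -!mulgA -!gmulfM; apply: Ltr.
Qed.

Lemma ltr_sim (u u' : A) (e : edge u u') (x x' : lpt u) (y y' : lpt u') :
  ltr e x y -> lpt_sim x x' -> lpt_sim y y' -> ltr e x' y'.
Proof.
move=> H [d ->] [d' ->]; case: H d d' => v w f b b' c d d' /=.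
by rewrite !mulgA -!gmulfM -!mulgA; apply: Ltr.
Qed.

(** The inversion principle of [ltr] at a given starting point: the remaining
    indices [u], [e] and [y] are dependent on each other, hence an equation
    between dependent pairs. *)
Lemma ltr_inversion (v : B) (u : A) (e : edge (mu v) u) a (y : lpt u) :
  ltr e (LPt a) y -> exists w (f : edge v w) b b' (c : egroup (mor_edge mu f)),
  existT (fun u => edge (mu v) u * lpt (mu v) * lpt u)%type u (e, LPt a, y) =
  existT (fun u => edge (mu v) u * lpt (mu v) * lpt u)%type (mu w)
    (mor_edge mu f,
     LPt (mor_v mu v b * (tw_alpha mu f * alpha (mor_edge mu f) c)),
     LPt (mor_v mu w b' * (tw_omega mu f * omega (mor_edge mu f) c))).
Proof.
pose T := {u : A & {u' : A & edge u u' * lpt u * lpt u'}%type}.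
pose tot u u' (e : edge u u') x y : T :=
  existT (fun u => {u' : A & edge u u' * lpt u * lpt u'}%type) u
    (existT (fun u' => edge u u' * lpt u * lpt u')%type u' (e, x, y)).
pose vert (s : T) : B := lpt_vert (projT2 (projT2 s)).1.2.
have H u1 u2 (e' : edge u1 u2) x' y' : ltr e' x' y' ->
    exists v w (f : edge v w) b b' (c : egroup (mor_edge mu f)),
    tot _ _ e' x' y' = tot _ _ (mor_edge mu f)
     (LPt (mor_v mu v b * (tw_alpha mu f * alpha (mor_edge mu f) c)))
     (LPt (mor_v mu w b' * (tw_omega mu f * omega (mor_edge mu f) c))).
  by case=> v1 w f b b0 c; exists v1, w, f, b, b0, c.
move=> /H [v' [w [f [b [b' [c E]]]]]].
have Ev : v = v' := congr1 vert E.
by subst v'; exists w, f, b, b', c; apply: existT_inj2 E.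
Qed.

Lemma ltrE (v w : B) (e : edge (mu v) (mu w)) a a' :
  ltr e (LPt a) (LPt a') -> exists (f : edge v w) b b' (c : egroup e),
  [/\ mor_edge mu f = e, a = mor_v mu v b * (tw_alpha mu f * alpha e c) &
      a' = mor_v mu w b' * (tw_omega mu f * omega e c)].
Proof.
move=> /ltr_inversion [w' [f [b [b' [c E]]]]].
have Ew : w = w' := congr1 (fun s => lpt_vert (projT2 s).2) E.
subst w'; have {}E := existT_inj2 E.
have Ee : e = _ := congr1 (fun t => t.1.1) E.
have /LPt_inj -> := congr1 (fun t => t.1.2) E.
have /LPt_inj -> := congr1 (fun t => t.2) E.
by subst e; exists f, b, b', c.
Qed.

(** Both immersion conditions are used: the first identifies the edges [f]
    and [f2] through their double cosets; by the second, the difference of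
    the two decompositions of [a] comes from the group of [f], and so
    disappears in the coset at the other end. *)
Lemma ltr_functional (u u' : A) (e : edge u u') (x : lpt u) (y y' : lpt u') :
  immersion mu -> ltr e x y -> ltr e x y' -> lpt_sim y y'.
Proof.
move=> [imm_i imm_ii] H; case: H y' => v w f b b' c y2.
case/ltr_inversion => w2 [f2 [b2 [b2' [c2 E]]]].
have Estar : in_star (mor_edge mu f) = in_star (mor_edge mu f2).
  exact: (congr1 (fun s => existT _ _ (projT2 s).1.1) E).
have Ea : mor_v mu v b * (tw_alpha mu f * alpha (mor_edge mu f) c) =
    mor_v mu v b2 * (tw_alpha mu f2 * alpha (mor_edge mu f2) c2).
  by apply: LPt_inj; have := congr1 (fun s => (projT2 s).1.2) E.
have Ef : in_star f = in_star f2.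
  apply/(imm_i _ _ _ _ _ Estar).
  suff K (s1 s2 : star (mu v)) g1 g2 (c1 : egroup (projT2 s1))
      (c2' : egroup (projT2 s2)) : s1 = s2 ->
      mor_v mu v b * (g1 * alpha (projT2 s1) c1) =
        mor_v mu v b2 * (g2 * alpha (projT2 s2) c2') ->
      dcoset (range (mor_v mu v)) g1 (range (alpha (projT2 s1))) =
      dcoset (range (mor_v mu v)) g2 (range (alpha (projT2 s2))).
    exact: (K (in_star _) (in_star _) _ _ _ _ Estar Ea).
  move=> Es; subst s2 => Eg; apply/dcoset_eq; exists (b2^-1 * b), (c1 * c2'^-1).
  rewrite !gmulfM !gmulfV -!mulgA (mulgA g1) (mulgA (mor_v mu v b)) Eg.
  by rewrite !mulgA mulVg mul1g mulgK.
have Ew : w = w2 := congr1 (@projT1 _ _) Ef.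
subst w2; have E' := existT_inj2 Ef; subst f2.
have E2 : y2 = _ := congr1 (fun t => t.2) (existT_inj2 E).
rewrite {}E2 {E}.
apply/lpt_simE.
have [_ [d _ <-] Ed] : [set alpha (mor_edge mu f) y | y in range (mor_e mu f)]
    (alpha (mor_edge mu f) (c2 * c^-1)).
  rewrite imm_ii; split; last by exists (c2 * c^-1).
  exists (mor_v mu v (b2^-1 * b)); first by exists (b2^-1 * b).
  rewrite !gmulfM !gmulfV conjgE.
  apply: (mulIg (alpha (mor_edge mu f) c)); rewrite mulgVK.
  apply: (mulgI (tw_alpha mu f)); rewrite !mulgA mulgV mul1g.
  by apply: (mulgI (mor_v mu v b2)); rewrite -Ea !mulgA mulgV mul1g.
have {}Ed := alpha_inj Ed.
have -> : c2 = mor_e mu f d * c by rewrite Ed mulgVK.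
exists (b2' * omega f d * b'^-1).
rewrite !mor_vM mor_vV omegaM mor_omegaE conjgE.
by rewrite !mulgA mulgVK mulgK.
Qed.

(** This is the surjectivity of the map from the star of [v] to double cosets
    in the definition of a covering. *)
Lemma ltr_total (u u' : A) (e : edge u u') (x : lpt u) :
  covering mu -> exists y, ltr e x y.
Proof.
case: x e => v a e [_ /(_ v) [_ _ surj]].
suff H (s : star (mu v)) (f : star v) : @star_map _ _ mu v f =
    (s, dcoset (range (mor_v mu v)) a (range (alpha (projT2 s)))) ->
    exists y, ltr (projT2 s) (LPt a) y.
  have [] := surj (in_star e, dcoset (range (mor_v mu v)) a (range (alpha e))).
    by exists a.
  by move=> f _ /H.
case: f => w f E; have Es : in_star (mor_edge mu f) = s := congr1 fst E.
subst s; have /dcoset_eq [b [c ->]] := congr1 snd E.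
exists (LPt (mor_v mu w 1 * (tw_omega mu f * omega (mor_edge mu f) c))).
by rewrite -mulgA; apply: Ltr.
Qed.

End LiftedPoints.

Section Fiber.
Variables (B A : graph_of_groups) (mu : morphism B A) (cov : covering mu).

Definition fpt (u : A) : Type := classes (@lpt_sim B A mu u).

Definition fcls (u : A) : lpt mu u -> fpt u := cls (@lpt_sim B A mu u).

Lemma fcls_eq (u : A) (x y : lpt mu u) : fcls x = fcls y <-> lpt_sim x y.
Proof.
apply: cls_eq; [exact: lpt_sim_refl|exact: lpt_sim_sym|exact: lpt_sim_trans].
Qed.

Lemma fcls_crepr (u : A) (x : lpt mu u) : lpt_sim (crepr (fcls x)) x.
Proof. by apply/fcls_eq; apply: creprK. Qed.

Definition fmul (u : A) (q : fpt u) (a : vgroup u) : fpt u :=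
  fcls (lpt_mul (crepr q) a).

Lemma fmul_cls (u : A) (x : lpt mu u) a : fmul (fcls x) a = fcls (lpt_mul x a).
Proof. exact/fcls_eq/lpt_sim_mul/fcls_crepr. Qed.

Definition ftr (u w : A) (e : edge u w) (q : fpt u) : fpt w :=
  fcls (projT1 (cid (ltr_total e (crepr q) cov))).

Lemma ftr_cls (u w : A) (e : edge u w) (x : lpt mu u) (y : lpt mu w) :
  ftr e (fcls x) = fcls y <-> ltr e x y.
Proof.
rewrite /ftr; case: cid => z /= /ltr_sim H; have {}H := H _ _ (fcls_crepr x).
split=> [/fcls_eq /H //|xy]; apply/fcls_eq.
by apply: ltr_functional xy; [case: cov|apply: H (lpt_sim_refl z)].
Qed.

Lemma fmul1 (u : A) (q : fpt u) : fmul q 1 = q.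
Proof.
rewrite -[q]creprK -/(fcls _) fmul_cls; case: (crepr q) => v a /=.
by rewrite mulg1.
Qed.

Lemma fmulM (u : A) (q : fpt u) (a b : vgroup u) :
  fmul q (a * b) = fmul (fmul q a) b.
Proof.
rewrite -[q]creprK -/(fcls _) !fmul_cls; case: (crepr q) a b => v c a b /=.
by rewrite mulgA.
Qed.

Lemma ftrK (u v : A) (e : edge u v) (q : fpt u) : ftr (einv e) (ftr e q) = q.
Proof.
rewrite -[q]creprK -/(fcls _); have [y xy] := ltr_total e (crepr q) cov.
by have /ftr_cls -> := xy; apply/ftr_cls/ltr_inv.
Qed.

Lemma ftr_alpha (u v : A) (e : edge u v) (q : fpt u) (c : egroup e) :
  ftr e (fmul q (alpha e c)) = fmul (ftr e q) (omega e c).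
Proof.
rewrite -[q]creprK -/(fcls _); have [y xy] := ltr_total e (crepr q) cov.
by have /ftr_cls -> := xy; rewrite !fmul_cls; apply/ftr_cls/ltr_alpha.
Qed.

(** The fibre of the covering [mu], with the monodromy action. *)
Definition fiber : graph_action A := GraphAction fmul1 fmulM ftrK ftr_alpha.

Definition fpoint (v : B) (a : vgroup (mu v)) : fiber (mu v) := fcls (LPt a).

Lemma fiber_clsP (u : A) (q : fiber u) : exists x : lpt mu u, q = fcls x.
Proof. by exists (crepr q); rewrite [fcls _]creprK. Qed.

Lemma pmul_cls (u : A) (x : lpt mu u) a :
  pmul (fcls x : fiber u) a = fcls (lpt_mul x a).
Proof. exact: fmul_cls. Qed.

Lemma ptr_cls (u w : A) (e : edge u w) (x : lpt mu u) (y : lpt mu w) :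
  ptr e (fcls x : fiber u) = fcls y <-> ltr e x y.
Proof. exact: ftr_cls. Qed.

End Fiber.

Section FiberPoints.
Variables (B A : graph_of_groups) (mu : morphism B A) (cov : covering mu).
Local Notation F := (fiber cov).

Lemma fiber_ind (P : forall u : A, F u -> Prop) :
  (forall (v : B) (a : vgroup (mu v)), P (mu v) (fpoint cov a)) ->
  forall (u : A) (q : F u), P u q.
Proof.
by move=> H u q; have [x ->] := fiber_clsP q; case: x => v a; apply: H.
Qed.

Lemma fpoint_eq (v : B) (a b : vgroup (mu v)) :
  fpoint cov a = fpoint cov b <-> exists c, b = mor_v mu v c * a.
Proof. by rewrite /fpoint fcls_eq lpt_simE. Qed.

(** A coset remembers the vertex of [B] to which it belongs, even when it is
    known only up to an equation between vertices of [A]. *)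
Lemma fpoint_vert (v w : B) (a : vgroup (mu v)) (b : vgroup (mu w)) :
  existT F (mu v) (fpoint cov a) = existT F (mu w) (fpoint cov b) -> v = w.
Proof.
have vertE x (c : vgroup (mu x)) : lpt_vert (crepr (fpoint cov c)) = x.
  by have [d E] := lpt_sim_sym (fcls_crepr (LPt c)); rewrite [crepr _]E.
move=> E; rewrite -(vertE v a) -(vertE w b).
exact: (congr1 (fun s : {u : A & F u} => lpt_vert (crepr (projT2 s))) E).
Qed.

Lemma pmul_fpoint (v : B) (a b : vgroup (mu v)) :
  pmul (fpoint cov a) b = fpoint cov (a * b).
Proof. exact: pmul_cls. Qed.

Lemma ptr_fpoint (v w : B) (f : edge v w) :
  ptr (mor_edge mu f) (fpoint cov (tw_alpha mu f)) = fpoint cov (tw_omega mu f).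
Proof.
apply/ptr_cls; have := Ltr (mu := mu) 1 1 (1 : egroup (mor_edge mu f)).
by rewrite !mor_v1 !gmulf1 !mul1g !mulg1.
Qed.

Lemma ptr_fpointE (v w : B) (e : edge (mu v) (mu w)) a a' :
  ptr e (fpoint cov a) = fpoint cov a' ->
  exists (f : edge v w) b b' (c : egroup e),
  [/\ mor_edge mu f = e, a = mor_v mu v b * (tw_alpha mu f * alpha e c) &
      a' = mor_v mu w b' * (tw_omega mu f * omega e c)].
Proof. by move/ptr_cls/ltrE. Qed.

(** The image of [q] lifts to [q] itself: the twisting elements inserted by
    [mor_path] are those met when crossing the edges. *)
Lemma pact_mor_path (v w : B) (q : apath v w) :
  pact (fpoint cov 1) (mor_path mu q) = fpoint cov 1.
Proof.
elim: q => [x b|x y z b f q IH] /=; rewrite pmul_fpoint mul1g.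
  by apply/fpoint_eq; exists b^-1; rewrite -mor_vM mulVg mor_v1.
have -> : fpoint cov (mor_v mu x b * tw_alpha mu f) =
    fpoint cov (tw_alpha mu f).
  by apply/fpoint_eq; exists b^-1; rewrite mulgA -mor_vM mulVg mor_v1 mul1g.
by rewrite ptr_fpoint pact_pmull pmul_fpoint mulgV.
Qed.

(** Turns the group element of a point into a path, so that lifting can be
    stated as a congruence without naming the vertex of [B] below the point. *)
Definition lpt_path (u : A) (x : lpt mu u) : apath (mu (lpt_vert x)) u :=
  let: LPt v a := x in PNil a.

Lemma ltr_path (u w : A) (e : edge u w) (x : lpt mu u) (y : lpt mu w) :
  ltr e x y -> exists q : apath (lpt_vert x) (lpt_vert y),
  pequiv (pcat (lpt_path x) (PCons 1 e (PNil 1)))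
         (pcat (mor_path mu q) (lpt_path y)).
Proof.
case=> {u w e x y} v w f b b' c; exists (PCons b f (PNil b'^-1)) => /=.
rewrite mor_vV mulg1 !mulgA mulgVK mulVg mul1g.
have := pequiv_slide (mor_v mu v b * tw_alpha mu f) c (PNil 1).
by rewrite /= mulg1.
Qed.

(** Path lifting: a path of [A] is, up to congruence, the image of a path of
    [B] followed by an element of the last vertex group, which is the point
    where the action of the path ends. *)
Lemma lift_path (u w : A) (p : apath u w) (x : lpt mu u) :
  exists (y : lpt mu w) (q : apath (lpt_vert x) (lpt_vert y)),
  pact (fcls x : F u) p = fcls y /\
  pequiv (pcat (lpt_path x) p) (pcat (mor_path mu q) (lpt_path y)).
Proof.
have nil_lift u1 (x1 : lpt mu u1) a :
    exists q : apath (lpt_vert x1) (lpt_vert (lpt_mul x1 a)),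
    pequiv (pcat (lpt_path x1) (PNil a))
      (pcat (mor_path mu q) (lpt_path (lpt_mul x1 a))).
  case: x1 a => v b a; exists (PNil 1) => /=; rewrite mor_v1 mul1g.
  exact: pequiv_refl.
elim: p x => [u1 a|u1 u2 u3 a e p IH] x /=; rewrite pmul_cls.
  by have [q pq] := nil_lift _ x a; exists (lpt_mul x a), q.
have [y xy] := ltr_total e (lpt_mul x a) cov; have /ptr_cls -> := xy.
have [z [q3 [E pq3]]] := IH y; exists z; rewrite E.
have [q1 pq1] := nil_lift _ x a; have [q2 pq2] := ltr_path xy.
exists (pcat q1 (pcat q2 q3)); split=> //.
rewrite !mor_path_cat -!pcatA.
apply: pequiv_trans (pequiv_cat (pequiv_refl _)
  (pequiv_cat (pequiv_refl _) pq3)).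
have := pequiv_cat pq1 (pequiv_refl (PCons 1 e p)).
rewrite -pcatA /= mulg1 => H; apply: pequiv_trans H _.
rewrite -pcatA; apply: pequiv_cat (pequiv_refl _) _.
have := pequiv_cat pq2 (pequiv_refl p); rewrite -!pcatA /=.
by rewrite pmull1.
Qed.

Lemma lift_path_loop (v w : B) (p : apath (mu v) (mu w)) :
  pact (fpoint cov 1) p = fpoint cov 1 <->
  exists q : apath v w, pequiv p (mor_path mu q).
Proof.
split=> [E|[q /pact_pequiv ->]]; last exact: pact_mor_path.
have [y [q [E' pq]]] := lift_path p (LPt (mu := mu) 1).
have : lpt_sim (LPt 1) y by apply/fcls_eq; rewrite -E' -[LHS]E.
case=> b Ey; subst y; exists (pcat q (PNil b)).
by rewrite mor_path_cat /= mulg1 pmull1 in pq *.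
Qed.

Lemma fiber_transitive (v : B) : connected B ->
  transitive_from (fpoint cov (1 : vgroup (mu v))).
Proof.
move=> /connected_apath conn; apply: fiber_ind => w a; have [q] := conn v w.
exists (pcat (mor_path mu q) (PNil a)).
by rewrite pact_cat pact_mor_path /= pmul_fpoint mul1g.
Qed.

(** The coset [mu(B_v)] as a point of the fibre over [u], transported along
    [mu v = u]. *)
Definition fbase (u : A) (v : B) (mu_v : mu v = u) : F u :=
  match mu_v in _ = w return F w with erefl => fpoint cov 1 end.

Lemma fbaseE (u : A) (v : B) (mu_v : mu v = u) :
  existT F u (fbase mu_v) = existT F (mu v) (fpoint cov 1).
Proof. by case: u / mu_v. Qed.

(** A loop of [A] fixes the base point exactly when it lifts to a loop. *)
Lemma pi1_imageE (u : A) (v : B) (mu_v : mu v = u) :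
  pi1_image mu_v = stabiliser (fbase mu_v).
Proof.
case: u / mu_v => /=; apply/seteqP; split=> [_ [x _ <-]|g].
  by apply/stabiliser_pi/pact_mor_path.
move=> /lift_path_loop [q pq]; exists (\pi_(pi1 v) q) => //.
by rewrite mor_pi1_pi -[RHS]reprK; apply/pi1P/pequiv_sym.
Qed.

Lemma fbase_transitive (u : A) (v : B) (mu_v : mu v = u) :
  connected B -> transitive_from (fbase mu_v).
Proof. by case: u / mu_v; apply: fiber_transitive. Qed.

End FiberPoints.

(** * The covering attached to an action *)

Section Transversals.
Variables (A : graph_of_groups) (X : graph_action A).

Definition vertex_transversal (rho : forall u : A, X u -> X u) : Prop :=
  (forall (u : A) (x : X u), exists a, rho u x = pmul x a) /\
  (forall (u : A) (x : X u) a, rho u (pmul x a) = rho u x).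

Definition edge_transversal (r : forall u v : A, edge u v -> X u -> X u) :
  Prop :=
  [/\ forall (u v : A) (e : edge u v) (x : X u),
        exists c, r u v e x = pmul x (alpha e c),
      forall (u v : A) (e : edge u v) (x : X u) (c : egroup e),
        r u v e (pmul x (alpha e c)) = r u v e x &
      forall (u v : A) (e : edge u v) (x : X u),
        r v u (einv e) (ptr e x) = ptr e (r u v e x)].

(** A choice of representatives for the orbits of [G] acting through [k], in
    which the points of [P], at most one in each orbit, represent themselves. *)
Lemma orbit_transversal (u : A) (G : groupType) (k : {ghom G -> vgroup u})
    (P : X u -> Prop) :
  (forall x y, P x -> P y -> (exists c, y = pmul x (k c)) -> x = y) ->
  exists s : X u -> X u,
  [/\ forall x, exists c, s x = pmul x (k c),
      forall x c, s (pmul x (k c)) = s x & forall x, P x -> s x = x].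
Proof.
move=> Puniq.
pose R (x y : X u) := exists c, y = pmul x (k c).
have Rrefl x : R x x by exists 1; rewrite gmulf1 pmul1.
have Rsym x y : R x y -> R y x.
  by move=> [c ->]; exists c^-1; rewrite -pmulM -gmulfM mulgV gmulf1 pmul1.
have Rtrans x y z : R x y -> R y z -> R x z.
  by move=> [c ->] [d ->]; exists (c * d); rewrite -pmulM -gmulfM.
have clsE := cls_eq Rrefl Rsym Rtrans.
have ch (q : classes R) : exists y, cls R y = q /\
    forall x, P x -> cls R x = q -> y = x.
  case: (pselect (exists2 x, P x & cls R x = q)) => [[x Px <-]|no].
    by exists x; split=> // y Py /clsE/Rsym; apply: Puniq.
  by exists (crepr q); split=> [|x Px E]; [apply: creprK|case: no; exists x].
exists (fun x => projT1 (cid (ch (cls R x)))); split=> [x|x c|x Px].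
- by case: cid => y /= [/clsE/Rsym].
- suff -> : cls R (pmul x (k c)) = cls R x by [].
  by apply/clsE/Rsym; exists c.
- by case: cid => y /= [_ H]; apply: H.
Qed.

(** The representative of the orbit of [x0] has to be [x0] itself, for
    otherwise the covering built below would have a conjugate of the
    stabiliser of [x0] as its group. *)
Lemma vertex_transversal_ex (u0 : A) (x0 : X u0) :
  exists2 rho, vertex_transversal rho & rho u0 x0 = x0.
Proof.
have ch u : exists s : X u -> X u,
  [/\ forall x, exists c, s x = pmul x c, forall x c, s (pmul x c) = s x &
      forall E : u0 = u, s (eq_rect u0 X x0 u E) = eq_rect u0 X x0 u E].
  have [|s [s1 s2 s3]] := @orbit_transversal u _
    (idfun : {ghom vgroup u -> vgroup u})
    (fun x => exists E : u0 = u, x = eq_rect u0 X x0 u E).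
    by move=> x y [E ->] [E' ->] _; rewrite (Prop_irrelevance E E').
  by exists s; split=> // E; apply: s3; exists E.
exists (fun u => projT1 (cid (ch u))).
  by split=> u; case: cid => s /= [].
by case: cid => s /= [_ _ /(_ erefl)].
Qed.

Lemma omega_einv (u v : A) (e : edge u v) (d : egroup (einv e)) :
  exists c : egroup e, omega (einv e) d = alpha e c.
Proof.
rewrite /omega /=; move: (erev (einv e) d); rewrite einvK => c; by exists c.
Qed.

(** The representatives for [e^-1] have to be those for [e] carried along
    [ptr e]: the edge groups of an edge and of its inverse are then
    identified by [erev] itself. This is where a symmetric choice is needed. *)
Lemma edge_transversal_ex : exists r, edge_transversal r.
Proof.
pose P u v (e : edge u v) (s : X u -> X u) (s' : X v -> X v) :=
  [/\ forall x, exists c, s x = pmul x (alpha e c),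
      forall x c, s (pmul x (alpha e c)) = s x &
      forall y, s' y = ptr e (s (ptr (einv e) y))].
have ptrVK u v (e : edge u v) (y : X v) : ptr e (ptr (einv e) y) = y.
  by have := ptrK (einv e) y; rewrite einvK.
have [r rP] : exists r : forall u v : A, edge u v -> X u -> X u,
    forall u v e, P u v e (r u v e) (r v u (einv e)).
  apply: (symmetric_choice (T := fun u => X u -> X u))
      => [u v e|u v e s s' [s1 s2 s'E]].
    have [//|s [s1 s2 _]] :=
      orbit_transversal (k := alpha e) (P := fun=> False).
    by exists s, (fun y => ptr e (s (ptr (einv e) y))).
  split=> [y|y d|x]; first 2 last.
  - by rewrite s'E einvK !ptrK.
  - have [c Ec] := s1 (ptr (einv e) y); exists (erev e c).
    by rewrite s'E Ec ptr_alpha ptrVK.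
  - have [c Ec] := omega_einv d.
    by rewrite !s'E ptr_alpha Ec s2.
exists r; split=> u v e; have [r1 r2 r3] := rP u v e => //.
by move=> x; rewrite r3 ptrK.
Qed.

End Transversals.

Section CoverOfAction.
Variables (A : graph_of_groups) (X : graph_action A).
Variables (rho : forall u : A, X u -> X u).
Variables (r : forall u v : A, edge u v -> X u -> X u).
Hypotheses (rhoP : vertex_transversal rho) (rP : edge_transversal r).

(** Orbits of vertex groups are encoded by their chosen representatives, the
    fixed points of [rho]. *)
Record cvert := CVert {
  cv_over : A;
  cv_pt : X cv_over;
  cvP : rho cv_pt = cv_pt }.

(** Likewise the fixed points of [r e] encode the orbits of the group of [e];
    the ends are the orbits of the point before and after crossing [e]. *)
Record cedge (v w : cvert) := CEdge {
  ce_over : edge (cv_over v) (cv_over w);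
  ce_pt : X (cv_over v);
  ceP : r ce_over ce_pt = ce_pt;
  ce_src : rho ce_pt = cv_pt v;
  ce_tgt : rho (ptr ce_over ce_pt) = cv_pt w }.

Lemma rhoK (u : A) (x : X u) : rho (rho x) = rho x.
Proof.
have [rho1 rho2] := rhoP; have [a Ea] := rho1 u x.
by rewrite [X in rho X]Ea rho2.
Qed.

Definition cvert_of (u : A) (x : X u) : cvert := CVert (rhoK x).

Lemma cvert_eq (v w : cvert) : existT X (cv_over v) (cv_pt v) =
  existT X (cv_over w) (cv_pt w) -> v = w.
Proof.
case: v w => u x Px [u' x' Px'] /= E.
have Eu : u = u' := congr1 (@projT1 _ _) E.
subst u'; have Ex := existT_inj2 E; subst x'.
by rewrite (Prop_irrelevance Px Px').
Qed.

Lemma cedge_eq (v w : cvert) (f f' : cedge v w) :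
  ce_over f = ce_over f' -> ce_pt f = ce_pt f' -> f = f'.
Proof.
case: f f' => e z h1 h2 h3 [e' z' h1' h2' h3'] /= Ee Ez; subst e' z'.
rewrite (Prop_irrelevance h1 h1') (Prop_irrelevance h2 h2').
by rewrite (Prop_irrelevance h3 h3').
Qed.

Lemma cinvP (v w : cvert) (f : cedge v w) :
  r (einv (ce_over f)) (ptr (ce_over f) (ce_pt f)) = ptr (ce_over f) (ce_pt f).
Proof. by have [_ _ ->] := rP; rewrite ceP. Qed.

Lemma cinv_tgt (v w : cvert) (f : cedge v w) :
  rho (ptr (einv (ce_over f)) (ptr (ce_over f) (ce_pt f))) = cv_pt v.
Proof. by rewrite ptrK ce_src. Qed.

Definition cinv (v w : cvert) (f : cedge v w) : cedge w v :=
  CEdge (cinvP f) (ce_tgt f) (cinv_tgt f).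

Lemma cinvK (v w : cvert) (f : cedge v w) : cinv (cinv f) = f.
Proof. by apply: cedge_eq => /=; [apply: einvK|apply: ptrK]. Qed.

Lemma cinv_neq (v : cvert) (f : cedge v v) : cinv f <> f.
Proof.
exact: (fun E => @einv_neq A _ (ce_over f) (congr1 (@ce_over v v) E)).
Qed.

Definition cgraph : graph := Graph cinvK cinv_neq.

Lemma vertex_stab_subgroup (v : cvert) :
  subgroup [set a | pmul (cv_pt v) a = cv_pt v].
Proof.
split=> [|a b]; rewrite ?inE /= ?pmul1 // => Ea Eb.
by rewrite pmulM Ea -[in LHS]Eb -pmulM mulgV pmul1.
Qed.

Lemma edge_stab_subgroup (v w : cvert) (f : cedge v w) :
  subgroup [set c | pmul (ce_pt f) (alpha (ce_over f) c) = ce_pt f].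
Proof.
split=> [|a b]; rewrite ?inE /= ?gmulf1 ?pmul1 // => Ea Eb.
by rewrite alphaM alphaV pmulM Ea -[in LHS]Eb -pmulM mulgV pmul1.
Qed.

Definition cvgroup (v : cgraph) : groupType := sgroup (vertex_stab_subgroup v).

Definition cegroup (v w : cgraph) (f : edge v w) : groupType :=
  sgroup (edge_stab_subgroup f).

Lemma cerev_subproof (v w : cgraph) (f : edge v w) (c : cegroup f) :
  pmul (ce_pt (cinv f))
    (alpha (ce_over (cinv f)) (erev (ce_over f) (sgval c))) =
  ce_pt (cinv f).
Proof.
have Ec : pmul _ _ = _ := sgvalP c.
rewrite -[LHS]/(pmul (ptr (ce_over f) (ce_pt f)) (omega (ce_over f) (sgval c))).
by rewrite -ptr_alpha Ec.
Qed.

Definition cerev_fun (v w : cgraph) (f : edge v w) (c : cegroup f) :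
    cegroup (einv f) :=
  sgSub (edge_stab_subgroup (cinv f)) (cerev_subproof c).

Lemma cerev_funM (v w : cgraph) (f : edge v w) :
  {morph @cerev_fun v w f : x y / x * y}.
Proof. by move=> x y; apply: sgval_inj; rewrite gmulfM /= !gmulfM. Qed.

Definition cerev (v w : cgraph) (f : edge v w) :
    {ghom cegroup f -> cegroup (einv f)} :=
  mk_ghom (@cerev_funM v w f).

(** The twisting element carries the representative [x] of a vertex orbit to
    the representative [z] of an edge orbit. It is chosen in terms of these
    two points alone, so that it is the same for [f] and for [f^-1^-1]. *)
Lemma ctwist_ex (u : A) (x z : X u) : exists a, rho z = x -> pmul x a = z.
Proof.
have [rho1 _] := rhoP; have [a Ea] := rho1 u z.
by exists a^-1 => <-; rewrite Ea -pmulM mulgV pmul1.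
Qed.

Definition ctwist_pt (u : A) (x z : X u) : vgroup u :=
  projT1 (cid (ctwist_ex x z)).

Definition ctwist (v w : cgraph) (f : edge v w) : vgroup (cv_over v) :=
  ctwist_pt (cv_pt v) (ce_pt f).

Lemma ctwistP (v w : cgraph) (f : edge v w) :
  pmul (cv_pt v) (ctwist f) = ce_pt f.
Proof.
by rewrite /ctwist /ctwist_pt; case: cid => a /= -> //; apply: ce_src.
Qed.

Lemma calpha_subproof (v w : cgraph) (f : edge v w) (c : cegroup f) :
  pmul (cv_pt v) (alpha (ce_over f) (sgval c) ^ (ctwist f)^-1) = cv_pt v.
Proof.
have Ec : pmul _ _ = _ := sgvalP c.
rewrite conjgE invgK !pmulM ctwistP Ec -ctwistP.
by rewrite -pmulM mulgV pmul1.
Qed.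

Definition calpha_fun (v w : cgraph) (f : edge v w) (c : cegroup f) :
    cvgroup v :=
  sgSub (vertex_stab_subgroup v) (calpha_subproof c).

Lemma calpha_funM (v w : cgraph) (f : edge v w) :
  {morph @calpha_fun v w f : x y / x * y}.
Proof. by move=> x y; apply: sgval_inj; rewrite gmulfM /= !gmulfM conjMg. Qed.

Definition calpha (v w : cgraph) (f : edge v w) :
    {ghom cegroup f -> cvgroup v} :=
  mk_ghom (@calpha_funM v w f).

Lemma calphaE (v w : cgraph) (f : edge v w) (c : cegroup f) :
  sgval (calpha f c) = alpha (ce_over f) (sgval c) ^ (ctwist f)^-1.
Proof. by []. Qed.

Lemma calpha_inj (v w : cgraph) (f : edge v w) : injective (calpha f).
Proof.
move=> x y /(congr1 sgval); rewrite !calphaE => /conjg_inj/alpha_inj.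
exact: sgval_inj.
Qed.

Lemma calpha_erev (v w : cgraph) (f : edge v w) (c : cegroup f) :
  calpha (einv (einv f)) (cerev (einv f) (cerev f c)) = calpha f c.
Proof.
apply: sgval_inj; rewrite !calphaE.
rewrite [X in X ^ _]alpha_erev; congr (_ ^ _^-1).
by rewrite /ctwist einvK.
Qed.

Definition cover : graph_of_groups := GraphOfGroups calpha_inj calpha_erev.

Definition cover_graph_morphism : graph_morphism cover A :=
  @GraphMorphism cover A cv_over (fun _ _ f => ce_over f) (fun _ _ _ => erefl).

Lemma cover_alphaE (v w : cover) (f : edge v w) (c : egroup f) :
  alpha (ce_over f) (sgval c) = sgval (alpha f c) ^ ctwist f.
Proof. by rewrite [alpha f c]/(calpha f c) calphaE conjgKV. Qed.

Lemma cover_omegaE (v w : cover) (f : edge v w) (c : egroup f) :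
  omega (ce_over f) (sgval c) = sgval (omega f c) ^ ctwist (einv f).
Proof. exact: cover_alphaE (erev f c). Qed.

Definition cover_mor : morphism cover A :=
  @Morphism cover A cover_graph_morphism
   (@GogData cover A cover_graph_morphism (fun v => sgval) (fun v => sgval_inj)
   (fun v w f => sgval) (fun v w f => sgval_inj) (fun v w f => ctwist f)
   cover_alphaE cover_omegaE).

(** If the twisting elements of [f] and [f'] differ by an element of the edge
    group (and by one fixing the point of [v]), their points are in the same
    orbit of the edge group, hence equal, being both representatives. *)
Lemma cover_star_eq (v w w' : cover) (f : edge v w) (f' : edge v w') :
  in_star (ce_over f) = in_star (ce_over f') ->
  edge_dcoset (mu := cover_mor) f = edge_dcoset (mu := cover_mor) f' ->
  in_star f = in_star f'.
Proof.
case: w f => u x Px f; case: w' f' => u' x' Px' f' Es Ed.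
have Eu : u = u' := congr1 (@projT1 _ _) Es.
subst u'; have Ee : ce_over f = ce_over f' := existT_inj2 Es.
have [b [c Et]] : exists (b : cvgroup v) c,
    ctwist f' = sgval b * ctwist f * alpha (ce_over f) c.
  apply/(dcoset_eq (sgval : {ghom cvgroup v -> _})).
  by rewrite [RHS](_ : _ = edge_dcoset (mu := cover_mor) f') -?Ed //
    /edge_dcoset Ee.
have Ez : ce_pt f = ce_pt f'.
  have Ez' : ce_pt f' = pmul (ce_pt f) (alpha (ce_over f) c).
    have Eb : pmul _ _ = _ := sgvalP b.
    by rewrite -ctwistP Et !pmulM Eb ctwistP.
  by have [_ r2 _] := rP; rewrite -[LHS]ceP -[RHS]ceP -Ee Ez' r2.
have Ex : x = x'.
  by rewrite -[x](ce_tgt f) -[x'](ce_tgt f') Ez; congr (rho (ptr _ _)).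
subst x'; rewrite (Prop_irrelevance Px' Px) in f' Es Ed Ee Et Ez *.
by congr existT; apply: cedge_eq.
Qed.

(** Double cosets of the stabiliser of [x] and of the edge group are the
    edge-group orbits within the vertex-group orbit of [x], which index the
    star by construction; the second immersion condition computes the
    stabiliser of the point of an edge. *)
Lemma cover_covering : covering cover_mor.
Proof.
split; first split.
- move=> v w w' f f' Es; split=> [Ef|]; last exact: cover_star_eq Es.
  exact: (congr1
    (fun s : star v => edge_dcoset (mu := cover_mor) (projT2 s)) Ef).
- move=> v w f; apply/seteqP.
  split=> [_ [_ [c _ <-] <-]|_ [[_ [b _ <-] <-] [c _ Ec]]].
    split; last by exists (sgval c).
    by exists (sgval (alpha f c)); [exists (alpha f c)|rewrite -cover_alphaE].
  have Hc : pmul (ce_pt f) (alpha (ce_over f) c) = ce_pt f.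
    have Eb : pmul _ _ = _ := sgvalP b.
    by rewrite [alpha _ _]Ec conjgE -ctwistP -pmulM mulVKg pmulM Eb.
  exists c => //; exists (sgSub (edge_stab_subgroup f) Hc) => //.
move=> v; split.
- by move=> f _; exists (tw_alpha cover_mor (projT2 f)).
- move=> [w f] [w' f'] _ _ E; apply: cover_star_eq.
    exact: (congr1 fst E).
  exact: (congr1 snd E).
move=> [[u e] D] [a /= ED].
have [r1 r2 r3] := rP; have [c Ec] := r1 _ _ e (pmul (cv_pt v) a).
set z := r e (pmul (cv_pt v) a) in Ec.
have hz : r e z = z by rewrite Ec r2.
have hs : rho z = cv_pt v.
  by have [_ rho2] := rhoP; rewrite Ec !rho2 cvP.
pose f : cedge v (cvert_of (ptr e z)) :=
  @CEdge v (cvert_of (ptr e z)) e z hz hs erefl.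
exists (in_star (f : @edge cover _ _)) => //=; congr pair.
rewrite ED; apply/esym/(dcoset_eq (sgval : {ghom cvgroup v -> _})).
have Hb : pmul (cv_pt v) (ctwist f * (a * alpha e c)^-1) = cv_pt v.
  by rewrite pmulM ctwistP /= Ec -!pmulM mulgA mulgV pmul1.
by exists (sgSub (vertex_stab_subgroup v) Hb), c; rewrite /= -mulgA mulgVK.
Qed.

(** The coset [mu(B_v) a] of the new covering is the point reached by [a]
    from the representative of the orbit [v]. *)
Definition cover_pt (u : A) (x : lpt cover_mor u) : X u :=
  match x in lpt _ u' return X u' with LPt v a => pmul (cv_pt v) a end.

Lemma cover_pt_sim (u : A) (x y : lpt cover_mor u) :
  cover_pt x = cover_pt y <-> lpt_sim x y.
Proof.
have [_ rho2] := rhoP; split=> [|[b ->]]; last first.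
  case: x b => v a b /=; have Eb : pmul _ _ = _ := sgvalP b.
  by rewrite pmulM Eb.
have vertE u1 (z : lpt cover_mor u1) :
    existT X u1 (rho (cover_pt z)) = existT X _ (cv_pt (lpt_vert z)).
  by case: z => v a /=; rewrite rho2 cvP.
move=> E; have Ev : lpt_vert x = lpt_vert y.
  by apply: cvert_eq; rewrite -!vertE E.
case: x y Ev E => v a y /= Ev.
have [b ->] : exists b, y = LPt b.
  have H u1 (z : lpt cover_mor u1) : v = lpt_vert z ->
      exists b, existT (lpt cover_mor) u1 z = existT _ _ (LPt (v := v) b).
    by case: z => w b /= ->; exists b.
  by have [b Eb] := H _ y Ev; exists b; apply: existT_inj2 Eb.
move=> /= E; apply/lpt_simE.
have Hb : pmul (cv_pt v) (b * a^-1) = cv_pt v.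
  by rewrite pmulM -E -pmulM mulgV pmul1.
by exists (sgSub (vertex_stab_subgroup v) Hb); rewrite /= mulgVK.
Qed.

Lemma cover_pt_ltr (u w : A) (e : edge u w) x y :
  ltr (mu := cover_mor) e x y -> ptr e (cover_pt x) = cover_pt y.
Proof.
case=> {u w e x y} v w f b b' c /=.
have Eb : pmul _ _ = _ := sgvalP b; have Eb' : pmul _ _ = _ := sgvalP b'.
rewrite !pmulM Eb Eb' [pmul (cv_pt v) _]ctwistP.
rewrite [pmul (cv_pt w) _](ctwistP (cinv f)).
exact: ptr_alpha.
Qed.

Definition cover_map (u : A) (q : fiber cover_covering u) : X u :=
  cover_pt (projT1 (cid (fiber_clsP q))).

Lemma cover_map_cls (u : A) (x : lpt cover_mor u) :
  cover_map (fcls x) = cover_pt x.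
Proof. by rewrite /cover_map; case: cid => y /= /fcls_eq/cover_pt_sim. Qed.

Lemma cover_map_inj (u : A) : injective (@cover_map u).
Proof.
move=> q q'; have [x ->] := fiber_clsP q; have [y ->] := fiber_clsP q'.
by rewrite !cover_map_cls => /cover_pt_sim/fcls_eq.
Qed.

Lemma cover_map_equivariant : equivariant cover_map.
Proof.
split=> [u q a|u w e q]; have [x ->] := fiber_clsP q.
  rewrite pmul_cls !cover_map_cls; case: x a => v b a /=.
  exact: pmulM.
have [y xy] := ltr_total e x cover_covering.
by have /ptr_cls -> := xy; rewrite !cover_map_cls (cover_pt_ltr xy).
Qed.

(** The injective equivariant map [cover_map] identifies the two points. *)
Lemma cover_stabiliser (v : cover) :
  stabiliser (fpoint cover_covering (1 : vgroup (cover_mor v))) =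
  stabiliser (cv_pt v).
Proof.
have Ev : cover_map (fpoint cover_covering (1 : vgroup (cover_mor v))) =
    cv_pt v.
  by rewrite cover_map_cls /= pmul1.
apply/seteqP; rewrite -Ev; split=> g.
  exact: equivariant_stabiliser cover_map_equivariant _.
rewrite /stabiliser /= -(equivariant_pact cover_map_equivariant).
exact: cover_map_inj.
Qed.

(** A path joining two points of the action lifts to a path of the covering
    joining the corresponding orbits. *)
Lemma cover_connected (v0 : cover) : transitive_from (cv_pt v0) ->
  connected cover.
Proof.
move=> trans.
have path_to (v : cover) : inhabited (apath v0 v).
  have [p Ep] := trans (cv_over v) (cv_pt v).
  have [y [q [Ey _]]] :=
    lift_path cover_covering p (LPt (mu := cover_mor) (v := v0) 1).
  have : lpt_sim (LPt (v := v) 1) y.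
    apply/cover_pt_sim; rewrite -(cover_map_cls y) -Ey.
    by rewrite (equivariant_pact cover_map_equivariant) cover_map_cls /= !pmul1.
  by case=> b Eb; subst y; split; exact: q.
split=> [|v w]; first by split.
have [q] := path_to v; have [q'] := path_to w.
elim: (pcat (pinv q) q') => [x _|x y z _ f _ IH]; first exact: rt_refl.
by apply: rt_trans IH; apply: rt_step.
Qed.

End CoverOfAction.

Lemma cover_of_action (A : graph_of_groups) (X : graph_action A) (u0 : A)
    (x0 : X u0) :
  transitive_from x0 ->
  exists (B : graph_of_groups) (mu : morphism B A) (v0 : B)
    (mu_v0 : mu v0 = u0),
  [/\ connected B, covering mu & pi1_image mu_v0 = stabiliser x0].
Proof.
move=> trans; have [rho rhoP rho_x0] := vertex_transversal_ex x0.
have [r rP] := edge_transversal_ex X.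
pose v0 : cover rhoP rP := CVert rho_x0.
exists (cover rhoP rP), (cover_mor rhoP rP), v0, erefl.
split; [exact: (cover_connected (v0 := v0))|exact: cover_covering|].
rewrite (pi1_imageE (cover_covering rhoP rP)).
exact: (@cover_stabiliser A X rho r rhoP rP v0).
Qed.

Lemma subgroup_covering (A : graph_of_groups) (u0 : A) (H : set (pi1 u0)) :
  subgroup H -> exists c : pointed_covering u0, pcov_subgroup c = H.
Proof.
move=> subH; have [B [mu [v0 [mu_v0 [conn cov E]]]]] :=
  cover_of_action (@coset_transitive A u0 H subH).
exists (PointedCovering conn mu_v0 cov).
by rewrite /pcov_subgroup /= E coset_stabiliser.
Qed.

(** * Equivalence of morphisms *)

Section EquivVia.
Variables (B A : graph_of_groups).

(** The equivalence of morphisms with its elements [a_v] made visible: the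
    pointed version constrains one of them. *)
Definition equiv_via (mu1 mu2 : morphism B A)
    (a : forall v : B, vgroup (mu1 v)) : Prop :=
  exists d2 : gog_data mu1, mu2 = Morphism d2 /\ data_equiv (mor_data mu1) d2 a.

Lemma mor_equivE (mu1 mu2 : morphism B A) :
  mor_equiv mu1 mu2 <-> exists a, @equiv_via mu1 mu2 a.
Proof.
split=> [[d2 [a [E H]]]|[a [d2 [E H]]]]; first by exists a, d2.
by exists d2, a.
Qed.

Lemma pmor_equivE (v0 : B) (mu1 mu2 : morphism B A) :
  pmor_equiv v0 mu1 mu2 <-> exists2 a, @equiv_via mu1 mu2 a & a v0 = 1.
Proof.
split=> [[d2 [a [E H a1]]]|[a [d2 [E H]] a1]].
  by exists a => //; exists d2.
by exists d2, a.
Qed.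

Lemma egroup_eq (u v : A) (e e' : edge u v) (c : egroup e) (c' : egroup e') :
  e = e' -> alpha e c = alpha e' c' ->
  existT (fun e => egroup e : Type) e c =
  existT (fun e => egroup e : Type) e' c'.
Proof. by move=> Ee; subst e' => /alpha_inj ->. Qed.

End EquivVia.

(** Composition of graph morphisms is associative except for the proofs
    contained in them, so data have to be carried between equal but not
    convertible graph morphisms. *)
Lemma gog_data_irrelevant (B A : graph_of_groups) (gv : B -> A)
    (ge : forall u v : B, edge u v -> edge (gv u) (gv v)) i i'
    (d : gog_data (GraphMorphism (gm_edge := ge) i)) :
  exists d' : gog_data (GraphMorphism (gm_edge := ge) i'),
  [/\ Morphism d = Morphism d', forall v x, gd_v d' v x = gd_v d v x &
      forall u v (f : edge u v), gd_twist d' f = gd_twist d f].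
Proof. by rewrite (Prop_irrelevance i' i); exists d. Qed.

(** As [alpha] is injective, the compatibility of the elements [a_f] with
    inversion can be tested in the vertex groups, where no transport between
    edge groups occurs. *)
Lemma data_equiv_omega (B A : graph_of_groups) (phi : graph_morphism B A)
    (a_e : forall (u v : B) (f : edge u v), egroup (gm_edge phi f)) :
  (forall (u v : B) (f : edge u v),
    existT (fun e => egroup e : Type) (gm_edge phi (einv f))
      (a_e v u (einv f)) =
    existT (fun e => egroup e : Type) (einv (gm_edge phi f))
      (erev (gm_edge phi f) (a_e u v f))) <->
  (forall (u v : B) (f : edge u v),
    alpha (gm_edge phi (einv f)) (a_e v u (einv f)) =
    omega (gm_edge phi f) (a_e u v f)).
Proof.
split=> H u v f; last by apply: egroup_eq; [apply: gm_inv|apply: H].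
exact: (congr1 (fun s : {e : edge (phi v) (phi u) & egroup e} =>
  alpha (projT1 s) (projT2 s)) (H u v f)).
Qed.

(** * Lifting morphisms through a covering *)

Lemma conj_twist (G : groupType) (a f b g c : G) :
  a * f = b * (g * c) -> f * c^-1 = a^-1 * (b * g).
Proof. by move=> E; apply: (mulgI a); rewrite mulgA E mulVKg !mulgA mulgK. Qed.

(** For each edge, the element [a_v f_alpha] is decomposed in the double
    coset of the image edge as [nu(b) g_alpha alpha(c)]. Then [b] serves as
    the twisting element of the lift and [c] as the element [a_f] of the
    equivalence, while the groups are mapped by conjugation with [a_v] and
    [c], followed by the inverse of [nu]. The second immersion condition
    makes that inverse available on edge groups. *)
Lemma lift_data (B C A : graph_of_groups) (nu : morphism C A)
    (g : graph_morphism B C) (d : gog_data (graph_comp nu g))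
    (a : forall v : B, vgroup (nu (g v))) (mu := Morphism d) :
  immersion nu ->
  (forall (v : B) (x : vgroup v), exists y,
     mor_v nu (g v) y = mor_v mu v x ^ (a v)^-1) ->
  (forall (v w : B) (f : edge v w),
     exists b b' (c : egroup (mor_edge nu (gm_edge g f))),
     a v * tw_alpha mu f =
       mor_v nu (g v) b * (tw_alpha nu (gm_edge g f) * alpha _ c) /\
     a w * tw_omega mu f =
       mor_v nu (g w) b' * (tw_omega nu (gm_edge g f) * omega _ c)) ->
  exists pd : gog_data g, equiv_via (mu1 := mor_comp nu (Morphism pd)) mu a.
Proof.
move=> [_ imm] Hv He.
pose Q v w (f : edge v w) b b' (c : egroup (mor_edge nu (gm_edge g f))) :=
  a v * tw_alpha mu f =
    mor_v nu (g v) b * (tw_alpha nu (gm_edge g f) * alpha _ c) /\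
  a w * tw_omega mu f =
    mor_v nu (g w) b' * (tw_omega nu (gm_edge g f) * omega _ c).
pose P v w (f : edge v w) b b' := exists c, Q v w f b b' c.
have [s sP] : exists s : forall v w : B, edge v w -> vgroup (g v),
    forall v w f, P v w f (s v w f) (s w v (einv f)).
  apply: (symmetric_choice (T := fun v => vgroup (g v))) => //.
  move=> v w f b b' [c [E1 E2]].
  rewrite /P /Q gm_inv /mor_edge gm_inv.
  exists (erev (mor_edge nu (gm_edge g f)) c).
  split; first exact: E2.
  rewrite {1}/tw_omega {1}/tw_omega !einvK E1 -[mor_edge _ _]/(gm_edge _ _).
  by rewrite omega_erev.
have [c cP] : exists c : forall v w (f : edge v w),
      egroup (mor_edge nu (gm_edge g f)),
    forall v w f, Q v w f (s v w f) (s w v (einv f)) (c v w f).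
  by exists (fun v w f => projT1 (cid (sP v w f))) => v w f; case: cid.
(* On vertex groups: conjugation by [a v], then the inverse of [nu]. *)
have [phi_v phi_vE] :
    exists phi : forall v : B, {ghom vgroup v -> vgroup (g v)},
    forall v x, mor_v nu (g v) (phi v x) = mor_v mu v x ^ (a v)^-1.
  have ch v : exists phi : {ghom vgroup v -> vgroup (g v)},
      forall x, mor_v nu (g v) (phi x) = mor_v mu v x ^ (a v)^-1.
    apply: ghom_choice => [|x y|//]; first exact: mor_v_inj.
    by rewrite mor_vM conjMg.
  by exists (fun v => projT1 (cid (ch v))) => v; case: cid.
have alpha_c v w (f : edge v w) x :
    alpha (mor_edge nu (gm_edge g f)) (mor_e mu f x ^ (c v w f)^-1) =
    mor_v nu (g v) (phi_v v (alpha f x) ^ s v w f) ^ tw_alpha nu (gm_edge g f).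
  have [E _] := cP v w f.
  rewrite alphaJ alphaV [alpha _ (mor_e mu f x)](mor_alphaE mu).
  rewrite mor_vJ phi_vE -!conjgM.
  by congr (_ ^ _); apply: (conj_twist E).
have omega_c v w (f : edge v w) x :
    omega (mor_edge nu (gm_edge g f)) (mor_e mu f x ^ (c v w f)^-1) =
    mor_v nu (g w) (phi_v w (omega f x) ^ s w v (einv f)) ^
      tw_omega nu (gm_edge g f).
  have [_ E] := cP v w f.
  rewrite omegaJ omegaV [omega _ (mor_e mu f x)](mor_omegaE mu).
  rewrite mor_vJ phi_vE -!conjgM.
  by congr (_ ^ _); apply: (conj_twist E).
have [phi_e phi_eE] : exists phi : forall (v w : B) (f : edge v w),
      {ghom egroup f -> egroup (gm_edge g f)},
    forall v w f x,
      mor_e nu (gm_edge g f) (phi v w f x) = mor_e mu f x ^ (c v w f)^-1.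
  have ch v w (f : edge v w) :
      exists phi : {ghom egroup f -> egroup (gm_edge g f)},
      forall x, mor_e nu (gm_edge g f) (phi x) = mor_e mu f x ^ (c v w f)^-1.
    apply: ghom_choice => [|x y|x]; first exact: mor_e_inj.
      by rewrite gmulfM conjMg.
    have : ([set x ^ tw_alpha nu (gm_edge g f) |
          x in range (mor_v nu (g v))] `&`
        range (alpha (mor_edge nu (gm_edge g f))))
       (alpha (mor_edge nu (gm_edge g f)) (mor_e mu f x ^ (c v w f)^-1)).
      split; last by eexists.
      rewrite alpha_c.
      by exists (mor_v nu (g v) (phi_v v (alpha f x) ^ s v w f)).
    by rewrite -imm => -[_ [y _ <-] /alpha_inj Ey]; exists y.
  by exists (fun v w f => projT1 (cid (ch v w f))) => v w f; case: cid.
have phi_v_inj v : injective (phi_v v).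
  move=> x y /(congr1 (mor_v nu (g v))); rewrite !phi_vE => /conjg_inj E.
  exact: (mor_v_inj (mu := mu) E).
have phi_e_inj v w (f : edge v w) : injective (phi_e v w f).
  move=> x y /(congr1 (mor_e nu (gm_edge g f))).
  rewrite !phi_eE => /conjg_inj E.
  exact: (mor_e_inj (mu := mu) E).
have phi_alpha v w (f : edge v w) x :
    alpha (gm_edge g f) (phi_e v w f x) = phi_v v (alpha f x) ^ s v w f.
  apply: (mor_v_inj (mu := nu)); apply: (conjg_inj (tw_alpha nu (gm_edge g f))).
  by rewrite -mor_alphaE phi_eE alpha_c.
have phi_omega v w (f : edge v w) x :
    omega (gm_edge g f) (phi_e v w f x) = phi_v w (omega f x) ^ s w v (einv f).
  apply: (mor_v_inj (mu := nu)); apply: (conjg_inj (tw_omega nu (gm_edge g f))).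
  by rewrite -mor_omegaE phi_eE omega_c.
exists (GogData phi_v_inj phi_e_inj phi_alpha phi_omega), d; split=> //.
exists c; split=> [v w f|v b|v w f].
- apply: egroup_eq; first exact: gm_inv.
  rewrite -[RHS]/(omega (mor_edge nu (gm_edge g f)) (c v w f)).
  have [_ E] := cP v w f; have [E' _] := cP w v (einv f).
  have Et : tw_alpha nu (gm_edge g (einv f)) = tw_omega nu (gm_edge g f).
    by rewrite gm_inv.
  apply: (mulgI (tw_omega nu (gm_edge g f))); rewrite -{1}Et.
  by apply: (mulgI (mor_v nu (g w) (s w v (einv f)))); rewrite -E -E'.
- rewrite -[gd_v _ v b]/(mor_v mu v b).
  by rewrite -[X in X ^ _]/(mor_v nu (g v) (phi_v v b)) phi_vE conjgKV.
- have [E _] := cP v w f; apply: (mulIg (tw_alpha mu f)); rewrite E mulgVK.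
  by rewrite /comp_twist mulgA.
Qed.

(** Double cosets that meet are equal, so the first immersion condition
    applies. *)
Lemma immersion_edge_unique (C A : graph_of_groups) (nu : morphism C A)
    (v w : C) (e : edge (nu v) (nu w)) (g g' : edge v w) b c b' c' :
  immersion nu -> mor_edge nu g = e -> mor_edge nu g' = e ->
  mor_v nu v b * (tw_alpha nu g * alpha e c) =
    mor_v nu v b' * (tw_alpha nu g' * alpha e c') ->
  g = g'.
Proof.
move=> [imm _] Eg Eg' E; apply: existT_inj2.
have Es : in_star (mor_edge nu g) = in_star (mor_edge nu g') by rewrite Eg Eg'.
apply/(imm _ _ _ _ _ Es); rewrite /edge_dcoset Eg Eg'; apply/dcoset_eq.
exists (b'^-1 * b), (c * c'^-1); rewrite mor_vM mor_vV alphaM alphaV.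
apply: (mulgI (mor_v nu v b')); apply: (mulIg (alpha e c')).
by rewrite !mulgA mulgV mul1g mulgVK -(mulgA (mor_v nu v b')) -E mulgA.
Qed.

(** The vertex [phi0 v] and the element [a0 v] are read off the image of the
    coset of [v]. Crossing [mu f] before or after applying [F] gives the edge
    of [C] and the decomposition required by [lift_data]. *)
Lemma lift_morphism (B C A : graph_of_groups) (mu : morphism B A)
    (nu : morphism C A) (cov_mu : covering mu) (cov_nu : covering nu)
    (F : forall u : A, fiber cov_mu u -> fiber cov_nu u)
    (phi0 : B -> C) (a0 : forall v : B, vgroup (nu (phi0 v))) :
  equivariant F ->
  (forall v : B, existT (fiber cov_nu) (mu v) (F (mu v) (fpoint cov_mu 1)) =
    existT (fiber cov_nu) (nu (phi0 v)) (fpoint cov_nu (a0 v))) ->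
  exists (phi : morphism B C) (a : forall v : B, vgroup (nu (phi v))),
    equiv_via (mu1 := mor_comp nu phi) mu a /\
    forall v : B, existT (fun w => vgroup (nu w) : Type) (phi v) (a v) =
      existT (fun w => vgroup (nu w) : Type) (phi0 v) (a0 v).
Proof.
move: cov_mu F; case: mu => [[mv me mi] md] cov_mu F [Fmul Ftr] HF.
(* Replacing the vertex map of [mu] by [nu] after [phi0], and later its edge map
   likewise, makes the types of both sides agree without transports. *)
have Emv : mv = (fun v => nu (phi0 v)).
  apply: functional_extensionality_dep => v.
  exact: (congr1 (@projT1 _ _) (HF v)).
subst mv; have {}HF v := existT_inj2 (HF v).
set mu := Morphism md in cov_mu F Fmul Ftr HF.
have Fpoint v (b : vgroup (mu v)) :
    F (mu v) (fpoint cov_mu b) = fpoint cov_nu (a0 v * b).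
  by rewrite -pmul_fpoint -HF -Fmul pmul_fpoint mul1g.
pose Q v w (f : edge v w) g := mor_edge nu g = me v w f /\
  exists b b' (c : egroup (me v w f)),
  a0 v * tw_alpha mu f =
    mor_v nu (phi0 v) b * (tw_alpha nu g * alpha _ c) /\
  a0 w * tw_omega mu f =
    mor_v nu (phi0 w) b' * (tw_omega nu g * omega _ c).
have [phi_e phi_eP] : exists phi_e :
      forall v w, edge v w -> edge (phi0 v) (phi0 w),
    forall v w f, Q v w f (phi_e v w f).
  have ch v w (f : edge v w) : exists g, Q v w f g.
    have := congr1 (F _) (ptr_fpoint cov_mu f).
    rewrite Ftr !Fpoint => /ptr_fpointE [g [b [b' [c [Eg E E']]]]].
    by exists g; split=> //; exists b, b', c.
  by exists (fun v w f => projT1 (cid (ch v w f))) => v w f; case: cid.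
have phi_inv v w (f : edge v w) : phi_e w v (einv f) = einv (phi_e v w f).
  have [Ef [b [b' [c [_ E]]]]] := phi_eP v w f.
  have [Ef' E'] := phi_eP w v (einv f); rewrite mi in Ef' E'.
  have [b2 [b2' [c2 [E2 _]]]] := E'.
  apply: (immersion_edge_unique (c := c2) (c' := erev _ c) (proj1 cov_nu)
    Ef' _ (etrans (esym E2) E)).
  by rewrite /mor_edge gm_inv -Ef.
have Eme : me = (fun v w f => mor_edge nu (phi_e v w f)).
  apply: functional_extensionality_dep => v.
  apply: functional_extensionality_dep => w.
  by apply: functional_extensionality_dep => f; have [] := phi_eP v w f.
(* The graph morphism of [mu] has become the composite of [nu] and [g]. *)
subst me; pose g := GraphMorphism phi_inv.
have Emi : mi = graph_comp_inv nu g by apply: Prop_irrelevance.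
subst mi.
have [|v x|v w f|pd pdP] := @lift_data B C A nu g md a0.
- exact: proj1 cov_nu.
(* [mu(x)] fixes the coset of [v], hence its image under [F]. *)
- have E : fpoint cov_mu (mor_v mu v x) = fpoint cov_mu 1.
    by apply/fpoint_eq; exists x^-1; rewrite -mor_vM mulVg mor_v1.
  have := congr1 (F _) E; rewrite !Fpoint mulg1 => /esym/fpoint_eq [y Ey].
  by exists y; rewrite conjgE invgK mulgA Ey mulgK.
- by have [_] := phi_eP v w f.
by exists (Morphism pd), a0; split.
Qed.

Section IdentityLift.
Variables (C A : graph_of_groups) (nu : morphism C A) (cov : covering nu).

(** Since [theta] fixes all cosets, it fixes the vertices, [a w] belongs to
    [nu(C_w)], and comparing double cosets it fixes the edges. The elements
    [c w] with [nu(c w) = a w] then make [theta] equivalent to the identity,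
    because [nu] is injective on groups. *)
Lemma equiv_via_id (theta : morphism C C)
    (a : forall w : C, vgroup (nu (theta w))) :
  equiv_via (mu1 := mor_comp nu theta) nu a ->
  (forall w : C, existT (fiber cov) (nu w) (fpoint cov 1) =
     existT (fiber cov) (nu (theta w)) (fpoint cov (a w))) ->
  exists2 c : forall w : C, vgroup (theta w), equiv_via (mor_id C) c &
    forall w, a w = 1 -> c w = 1.
Proof.
case: theta a => [[tv te ti] td] a Heq HF.
have Etv : tv = (fun w => w).
  apply: functional_extensionality_dep => w.
  exact/esym/(fpoint_vert (HF w)).
subst tv; have [c cE] : exists c : forall w : C, vgroup w,
    forall w, a w = mor_v nu w (c w).
  have ch w : exists c, a w = mor_v nu w c.
    have /fpoint_eq [c ->] := existT_inj2 (HF w).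
    by exists c; rewrite mulg1.
  by exists (fun w => projT1 (cid (ch w))) => w; case: cid.
have [d2 [Enu [a_e [/data_equiv_omega Hrev Hv Ht]]]] := Heq.
have Etw w w' (f : edge w w') : gd_twist d2 f = tw_alpha nu f.
  exact/esym/(existT_inj2 (congr1 (fun m : morphism C A =>
    existT (fun u => vgroup u : Type) (m w) (tw_alpha m f)) Enu)).
have Ev w x : gd_v d2 w x = mor_v nu w x.
  exact/esym/(existT_inj2 (congr1 (fun m : morphism C A =>
    existT (fun u => vgroup u : Type) (m w) (mor_v m w x)) Enu)).
have Ee w w' (f : edge w w') : mor_edge nu (te w w' f) = mor_edge nu f.
  exact/esym/(existT_inj2 (congr1 (fun m : morphism C A =>
    existT (fun s : A * A => edge s.1 s.2) (m w, m w') (mor_edge m f)) Enu)).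
have Hta w w' (f : edge w w') : mor_v nu w (c w) * tw_alpha nu f =
    mor_v nu w (gd_twist td f) *
      (tw_alpha nu (te w w' f) * alpha _ (a_e _ _ f)).
  by rewrite -cE (Ht _ _ f) Etw mulgVK /= /comp_twist mulgA.
(* Both edges lie over the same edge of [A]; the double coset of [te f] differs
   from that of [f] by elements of [nu(C_w)] and of the edge group. *)
have Ete : te = (fun w w' f => f).
  apply: functional_extensionality_dep => w.
  apply: functional_extensionality_dep => w'.
  apply: functional_extensionality_dep => f.
  apply: (immersion_edge_unique (b' := c w) (c' := 1) (proj1 cov)
    erefl (esym (Ee w w' f)) _).
  by rewrite gmulf1 mulg1; apply/esym/Hta.
subst te; have Eti : ti = (fun _ _ _ => erefl) by apply: Prop_irrelevance.
subst ti.
have [c_e c_eE] : exists c_e : forall w w' (f : edge w w'), egroup f,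
    forall w w' f, mor_e nu f (c_e w w' f) = a_e w w' f.
  have ch w w' (f : edge w w') : exists x, mor_e nu f x = a_e w w' f.
    have : ([set x ^ tw_alpha nu f | x in range (mor_v nu w)] `&`
       range (alpha (mor_edge nu f))) (alpha (mor_edge nu f) (a_e w w' f)).
      split; last by exists (a_e w w' f).
      exists (mor_v nu w ((gd_twist td f)^-1 * c w)); first by eexists.
      apply: (mulgI (tw_alpha nu f)).
      apply: (mulgI (mor_v nu w (gd_twist td f))).
      by rewrite -[RHS]Hta conjgE mor_vM mor_vV !mulgA mulgK mulgV mul1g.
    by rewrite -(proj2 (proj1 cov)) => -[_ [x _ <-] /alpha_inj Ex]; exists x.
  by exists (fun w w' f => projT1 (cid (ch w w' f))) => w w' f; case: cid.
exists c; last first.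
  by move=> w a1; apply: (mor_v_inj (mu := nu)); rewrite -cE a1 mor_v1.
exists (mor_data (mor_id C)); split=> //; exists c_e; split.
- apply/data_equiv_omega => w w' f; apply: (mor_v_inj (mu := nu)).
  apply: (conjg_inj (tw_omega nu f)); rewrite -mor_omegaE c_eE.
  by rewrite -[LHS]mor_alphaE c_eE Hrev.
- move=> w x; apply: (mor_v_inj (mu := nu)); rewrite mor_vJ -cE.
  by rewrite -Ev Hv.
- move=> w w' f; apply: (mor_v_inj (mu := nu)); apply: (mulIg (tw_alpha nu f)).
  rewrite Hta /= invg1 mulg1 mor_vM -c_eE mor_alphaE conjgE mulgA.
  by rewrite !mulgA mulgK.
Qed.

End IdentityLift.

(** The twisting elements of a composite of equivalences: [x ^ a] comes from
    passing the inner twisting element through the outer equivalence. *)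
Lemma comp_twist_step (G : groupType) (a x t t' c d b e : G) :
  a = t * t' * c * d^-1 ->
  a * (x ^ a * d * b * e^-1) = x * t * t' * (c * b) * e^-1.
Proof.
move=> Ea; have ad : a * d = t * t' * c by rewrite Ea mulgVK.
by rewrite conjgE !mulgA mulgV mul1g -(mulgA x a d) ad !mulgA.
Qed.

Section ComposeLifts.
Variables (B C A : graph_of_groups).

Lemma equiv_via_comp (mu : morphism B A) (nu : morphism C A)
    (cov_mu : covering mu) (cov_nu : covering nu)
    (F : forall u : A, fiber cov_mu u -> fiber cov_nu u)
    (G : forall u : A, fiber cov_nu u -> fiber cov_mu u)
    (phi : morphism B C) (psi : morphism C B)
    (a : forall v : B, vgroup (nu (phi v)))
    (b : forall w : C, vgroup (mu (psi w))) :
  equivariant F -> (forall (u : A) (y : fiber cov_nu u), F u (G u y) = y) ->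
  equiv_via (mu1 := mor_comp nu phi) mu a ->
  equiv_via (mu1 := mor_comp mu psi) nu b ->
  (forall v : B, existT (fiber cov_nu) (mu v) (F (mu v) (fpoint cov_mu 1)) =
    existT (fiber cov_nu) (nu (phi v)) (fpoint cov_nu (a v))) ->
  (forall w : C, existT (fiber cov_mu) (nu w) (G (nu w) (fpoint cov_nu 1)) =
    existT (fiber cov_mu) (mu (psi w)) (fpoint cov_mu (b w))) ->
  exists ab : forall w : C, vgroup (nu (phi (psi w))),
  [/\ equiv_via (mu1 := mor_comp nu (mor_comp phi psi)) nu ab,
      forall w : C, existT (fiber cov_nu) (nu w) (fpoint cov_nu 1) =
        existT (fiber cov_nu) (nu (phi (psi w))) (fpoint cov_nu (ab w)) &
      forall w, a (psi w) = 1 -> b w = 1 -> ab w = 1].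
Proof.
move=> [Fmul _] FG [d [Emu [a_e [/data_equiv_omega Hrev Hv Ht]]]].
subst mu => -[e2 [Enu [b_e [/data_equiv_omega Hrev' Hv' Ht']]]] HF HG.
(* [a (psi w)] leads from [nu phi psi] to [mu psi], and [b w] to [nu]. *)
exists (fun w => a (psi w) * b w); split; last by move=> w -> ->; rewrite mulg1.
  have [e [Ee ev et]] := @gog_data_irrelevant C A (fun w => nu (phi (psi w)))
    (fun _ _ f => gm_edge nu (gm_edge phi (gm_edge psi f)))
    (@graph_comp_inv _ _ _ (graph_comp nu phi) psi)
    (@graph_comp_inv _ _ _ nu (graph_comp phi psi)) e2.
  exists e; split; first by rewrite {1}Enu Ee.
  exists (fun w w' f => a_e _ _ (gm_edge psi f) * b_e w w' f); split.
  - apply/data_equiv_omega => w w' f; rewrite alphaM omegaM.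
    congr (_ * _); last exact: Hrev'.
    have H h : h = einv (gm_edge psi f) ->
        alpha (gm_edge (graph_comp nu phi) h) (a_e _ _ h) =
        omega (gm_edge (graph_comp nu phi) (gm_edge psi f))
          (a_e _ _ (gm_edge psi f)).
      by move=> ->; apply: Hrev.
    exact/H/gm_inv.
  - by move=> w x; rewrite ev Hv' /= /comp_v /= Hv -conjgM.
  - move=> w w' f.
    rewrite (Ht' _ _ f) et /= /comp_twist alphaM.
    rewrite [mor_v (Morphism d) _ _](Hv _ (tw_alpha psi f)).
    rewrite [tw_alpha (Morphism d) _]/(gd_twist d (gm_edge psi f)).
    rewrite [tw_alpha (mor_comp phi psi) f]/(comp_twist phi psi f) mor_vM.
    exact: comp_twist_step (Ht _ _ (gm_edge psi f)).
move=> w; have := congr1 (fun s : {u : A & fiber cov_mu u} =>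
  existT (fiber cov_nu) (projT1 s) (F _ (projT2 s))) (HG w).
rewrite /= FG => ->; congr existT.
have HF' := existT_inj2 (HF (psi w)).
rewrite -[b w in LHS]mul1g -[LHS](congr1 (F _) (pmul_fpoint _ _ _)).
by rewrite Fmul HF' pmul_fpoint.
Qed.

End ComposeLifts.

Section IsoOfFibers.
Variables (B C A : graph_of_groups) (mu : morphism B A) (nu : morphism C A).
Variables (cov_mu : covering mu) (cov_nu : covering nu).

(** The element [a v] is only determined up to left multiplication by the
    image of a vertex group; taking the value [1] whenever it is possible
    preserves base points strictly. *)
Lemma lift_morphism_normalised
    (F : forall u : A, fiber cov_mu u -> fiber cov_nu u) :
  equivariant F ->
  exists (phi : morphism B C) (a : forall v : B, vgroup (nu (phi v))),
  [/\ equiv_via (mu1 := mor_comp nu phi) mu a,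
      forall v : B, existT (fiber cov_nu) (mu v) (F (mu v) (fpoint cov_mu 1)) =
        existT (fiber cov_nu) (nu (phi v)) (fpoint cov_nu (a v)) &
      forall (v : B) (w : C),
        existT (fiber cov_nu) (mu v) (F (mu v) (fpoint cov_mu 1)) =
        existT (fiber cov_nu) (nu w) (fpoint cov_nu 1) ->
        phi v = w /\ a v = 1].
Proof.
move=> Feq.
pose pt_of (t : {w : C & vgroup (nu w)}) :=
  existT (fiber cov_nu) (nu (projT1 t)) (fpoint cov_nu (projT2 t)).
pose at1 (w : C) := existT (fun w => vgroup (nu w) : Type) w 1.
pose Fpt v := existT (fiber cov_nu) (mu v) (F (mu v) (fpoint cov_mu 1)).
have /choice [t tP] : forall v, exists t, Fpt v = pt_of t /\
    ((exists w, Fpt v = pt_of (at1 w)) -> projT2 t = 1).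
  move=> v; case: (pselect (exists w, Fpt v = pt_of (at1 w))) => [[w E]|no].
    by exists (at1 w).
  have [t Et] : exists t, Fpt v = pt_of t.
    rewrite /Fpt; move: (F _ _); move: (mu v); apply: fiber_ind => w b.
    by exists (existT _ w b).
  by exists t.
have HF v : Fpt v = pt_of (t v) by case: (tP v).
have [phi [a [Ea at_]]] := lift_morphism (a0 := fun v => projT2 (t v)) Feq HF.
have at' v : existT _ (phi v) (a v) = t v by rewrite at_ -sigT_eta.
exists phi, a; split=> [//|v|v w E].
  by rewrite -[LHS]/(Fpt v) (HF v) -at'.
have [E1 E2] := tP v; rewrite -at' in E1 E2; split.
  exact: (fpoint_vert (etrans (esym E1) E)).
by apply: E2; exists w.
Qed.

End IsoOfFibers.

Lemma covering_iso (B C A : graph_of_groups) (mu : morphism B A)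
    (nu : morphism C A) (cov_mu : covering mu) (cov_nu : covering nu)
    (F : forall u : A, fiber cov_mu u -> fiber cov_nu u)
    (G : forall u : A, fiber cov_nu u -> fiber cov_mu u) :
  equivariant F -> equivariant G ->
  (forall (u : A) (x : fiber cov_mu u), G u (F u x) = x) ->
  (forall (u : A) (y : fiber cov_nu u), F u (G u y) = y) ->
  exists (phi : morphism B C) (psi : morphism C B) a c d,
  [/\ equiv_via (mu1 := mor_comp phi psi) (mor_id C) c,
      equiv_via (mu1 := mor_comp psi phi) (mor_id B) d,
      equiv_via (mu1 := mor_comp nu phi) mu a &
      forall (v : B) (w : C),
        existT (fiber cov_nu) (mu v) (F (mu v) (fpoint cov_mu 1)) =
        existT (fiber cov_nu) (nu w) (fpoint cov_nu 1) ->
        [/\ phi v = w, psi w = v, a v = 1, c w = 1 & d v = 1]].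
Proof.
move=> Feq Geq GF FG.
have [phi [a [Ea HF aP]]] := lift_morphism_normalised Feq.
have [psi [b [Eb HG bP]]] := lift_morphism_normalised Geq.
have [ab [Eab HFG ab1]] := equiv_via_comp Feq FG Ea Eb HF HG.
have [ba [Eba HGF ba1]] := equiv_via_comp Geq GF Eb Ea HG HF.
have [c Ec c1] := equiv_via_id Eab HFG; have [d Ed d1] := equiv_via_id Eba HGF.
exists phi, psi, a, c, d; split=> // v w E.
have [Ephi a1] := aP v w E.
have [Epsi b1] : psi w = v /\ b w = 1.
  apply: bP; have := congr1 (fun s : {u : A & fiber cov_nu u} =>
    existT (fiber cov_mu) (projT1 s) (G _ (projT2 s))) E.
  by rewrite /= GF => ->.
split=> //.
- by apply: c1; apply: ab1 => //; rewrite Epsi.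
- by apply: d1; apply: ba1 => //; rewrite Ephi.
Qed.

(** * Images of fundamental groups *)

Section ImageOfEquivalent.
Variables (B A : graph_of_groups).

Lemma equiv_via_vertex (mu1 mu2 : morphism B A) a (v : B) :
  @equiv_via B A mu1 mu2 a -> mu2 v = mu1 v.
Proof. by case=> d [-> _]. Qed.

(** Equivalent morphisms differ on a path by the elements attached to its two
    ends; those of inner vertices cancel, and those of edges slide across. *)
Lemma equiv_via_path (mu1 : morphism B A) (d2 : gog_data mu1) a (v w : B)
    (q : apath v w) :
  data_equiv (mor_data mu1) d2 a ->
  pequiv (mor_path (Morphism d2) q)
    (pmull (a v)^-1 (pcat (mor_path mu1 q) (PNil (a w)))).
Proof.
move=> [a_e [/data_equiv_omega Hrev Hv Ht]].
elim: q => [x b|x y z b f q IH] /=.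
  by rewrite [mor_v (Morphism d2) _ _]Hv conjgE mulgA; apply: pequiv_refl.
have Et : mor_v (Morphism d2) x b * tw_alpha (Morphism d2) f =
    (a x)^-1 * (mor_v mu1 x b * tw_alpha mu1 f) *
      alpha (mor_edge mu1 f) (a_e _ _ f).
  rewrite [mor_v (Morphism d2) x b]Hv conjgE -!mulgA.
  congr (_ * (_ * _)); apply: (mulIg (tw_alpha (Morphism d2) f)^-1).
  by rewrite mulgK [LHS](Ht _ _ f).
have Etw : (tw_omega (Morphism d2) f)^-1 * (a y)^-1 =
    (omega (mor_edge mu1 f) (a_e _ _ f))^-1 * (tw_omega mu1 f)^-1.
  rewrite -!invgM; congr _^-1; rewrite -Hrev (Ht _ _ (einv f)).
  by rewrite mulgVK.
rewrite Et.
apply: pequiv_trans (pequiv_slide _ _ _) _; apply: pequiv_cons.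
rewrite pcat_pmull pmullM; apply: pequiv_trans (pequiv_pmull _ IH) _.
rewrite pmullM -mulgA Etw mulVKg.
exact: pequiv_refl.
Qed.

(** On loops the difference is conjugation by the class of [a v]. *)
Lemma equiv_via_image (mu1 mu2 : morphism B A) a (v : B) (u : A)
    (h1 : mu1 v = u) (h2 : mu2 v = u) : @equiv_via B A mu1 mu2 a ->
  exists g,
    pi1_image h2 = [set x ^ g | x in pi1_image h1] /\ (a v = 1 -> g = 1).
Proof.
case=> d2 [E2 H]; subst mu2; case: u / h1 h2 => h2.
rewrite (Prop_irrelevance h2 erefl) /=; exists (\pi_(pi1 (mu1 v)) (PNil (a v))).
split; last by move=> ->.
have E q : \pi_(pi1 (mu1 v)) (mor_path (Morphism d2) q) =
    \pi_(pi1 (mu1 v)) (mor_path mu1 q) ^ \pi_(pi1 (mu1 v)) (PNil (a v)).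
  rewrite conjgE -pi1_piV -(pi1_piM (mor_path mu1 q)) -(pi1_piM (pinv _)).
  apply/pi1P.
  exact: equiv_via_path.
apply/seteqP; split=> [_ [x _ <-]|_ [_ [x _ <-] <-]].
  exists (mor_pi1 mu1 x); first by exists x.
  by rewrite /mor_pi1 E.
by exists x => //; rewrite /mor_pi1 E.
Qed.

End ImageOfEquivalent.

Section ImageOfComposite.
Variables (B C A : graph_of_groups) (nu : morphism C A) (phi : morphism B C).

Lemma mor_path_comp (v w : B) (q : apath v w) :
  mor_path (mor_comp nu phi) q = mor_path nu (mor_path phi q).
Proof.
elim: q => [x b|x y z b f q IH] //=; rewrite IH mor_path_pmull pmullM.
have -> : tw_omega (mor_comp nu phi) f =
    mor_v nu _ (tw_omega phi f) * tw_omega nu (mor_edge phi f).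
  by rewrite {3}/tw_omega -gm_inv.
by rewrite mor_vM -mulgA invgM mor_vV.
Qed.

Lemma mor_pi1_comp (v : B) (x : pi1 v) :
  mor_pi1 (mor_comp nu phi) x = mor_pi1 nu (mor_pi1 phi x).
Proof.
rewrite {1}/mor_pi1 mor_path_comp.
exact: esym (mor_pi1_pi nu (mor_path phi (repr x))).
Qed.

Lemma pi1_image_comp (v : B) (w : C) (u : A) (h : phi v = w) (h' : nu w = u)
    (h'' : mor_comp nu phi v = u) :
  pi1_image h'' `<=` pi1_image h'.
Proof.
case: w / h h'; case: u / h'' => h'; rewrite (Prop_irrelevance h' erefl) /=.
by move=> _ [x _ <-]; exists (mor_pi1 phi x) => //; rewrite mor_pi1_comp.
Qed.

(** The hypothesis says that [phi] is surjective on fundamental groups. *)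
Lemma pi1_image_comp_full (v : B) (w : C) (u : A) (h : phi v = w)
    (h' : nu w = u) (h'' : mor_comp nu phi v = u) :
  pi1_image h = setT -> pi1_image h'' = pi1_image h'.
Proof.
move=> full; apply/seteqP; split; first exact: pi1_image_comp.
move: full; case: w / h h'; case: u / h'' => h'.
rewrite (Prop_irrelevance h' erefl) /= => full _ [y _ <-].
have [x _ <-] : range (mor_pi1 phi (v := v)) y by rewrite full.
by exists x => //; rewrite mor_pi1_comp.
Qed.

End ImageOfComposite.

Lemma pi1_image_id (C : graph_of_groups) (w w' : C) (h : mor_id C w = w') :
  pi1_image h = setT.
Proof.
case: w' / h; apply/seteqP; split=> // x _; exists x => //.
have idE v v' (q : apath v v') : mor_path (mor_id C) q = q.
  by elim: q => [y b|y y' y'' b f q IH] //=; rewrite IH mulg1 invg1 pmull1.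
by rewrite /mor_pi1 idE reprK.
Qed.

(** As [phi psi] is equivalent to the identity, it is surjective on
    fundamental groups; so is [phi], and [nu phi] has the same image as [nu]. *)
Lemma iso_pi1_image (B C A : graph_of_groups) (mu : morphism B A)
    (nu : morphism C A) (phi : morphism B C) (psi : morphism C B) a c
    (v : B) (w : C) (u : A) (h : mu v = u) (h' : nu w = u) :
  equiv_via (mu1 := mor_comp phi psi) (mor_id C) c ->
  equiv_via (mu1 := mor_comp nu phi) mu a ->
  phi v = w -> psi w = v ->
  exists g, pi1_image h = [set x ^ g | x in pi1_image h'] /\ (a v = 1 -> g = 1).
Proof.
move=> Ec Ea Ephi Epsi.
have Ew : mor_comp phi psi w = w by rewrite -(equiv_via_vertex w Ec).
have [g [E _]] := equiv_via_image Ew (erefl : mor_id C w = w) Ec.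
have full : pi1_image Ephi = setT.
  apply/seteqP; split=> // x _.
  apply: (pi1_image_comp Epsi Ephi (h'' := Ew)).
  have : [set: pi1 w] (x ^ g) by [].
  rewrite -(pi1_image_id (erefl : mor_id C w = w)) E.
  by move=> -[y Hy /conjg_inj <-].
have Ev : mor_comp nu phi v = u by rewrite -(equiv_via_vertex v Ea).
have [g' [E' g1]] := equiv_via_image Ev h Ea.
by exists g'; rewrite E' (pi1_image_comp_full h' Ev full).
Qed.

Lemma conj_set1 (G : groupType) (H : set G) : [set h ^ 1 | h in H] = H.
Proof.
apply/seteqP; split=> [_ [h Hh <-]|h Hh]; first by rewrite conjg1.
by exists h; rewrite ?conjg1.
Qed.

Lemma conj_setM (G : groupType) (H : set G) (g k : G) :
  [set h ^ k | h in [set h ^ g | h in H]] = [set h ^ (g * k) | h in H].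
Proof.
apply/seteqP; split=> [_ [_ [h Hh <-] <-]|_ [h Hh <-]].
  by exists h; rewrite ?conjgM.
by exists (h ^ g); [exists h|rewrite conjgM].
Qed.

Lemma conj_class_conj (G : groupType) (H : set G) (g : G) :
  conj_class [set h ^ g | h in H] = conj_class H.
Proof.
apply/seteqP; split=> _ [k _ <-]; first by exists (g * k); rewrite ?conj_setM.
by exists (g^-1 * k) => //; rewrite conj_setM mulVKg.
Qed.

Lemma conj_class_eq (G : groupType) (H K : set G) :
  conj_class H = conj_class K -> exists g, H = [set h ^ g | h in K].
Proof.
move=> E; have : conj_class H H by exists 1; rewrite ?conj_set1.
by rewrite E => -[g _ <-]; exists g.
Qed.

Lemma pi1_image_subgroup (B A : graph_of_groups) (mu : morphism B A) (v : B)
    (u : A) (h : mu v = u) : covering mu -> subgroup (pi1_image h).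
Proof. by move=> cov; rewrite (pi1_imageE cov); apply: stabiliser_subgroup. Qed.

(** The base points over [u] lie in one orbit when [B] is connected. *)
Lemma pi1_image_vertex (B A : graph_of_groups) (mu : morphism B A) (v w : B)
    (u : A) (h : mu v = u) (h' : mu w = u) : covering mu -> connected B ->
  conj_class (pi1_image h) = conj_class (pi1_image h').
Proof.
move=> cov conn; rewrite !(pi1_imageE cov).
have [p ->] := fbase_transitive h' conn (fbase cov h).
by rewrite stabiliser_pact conj_class_conj.
Qed.

(** The end of a lifted path lies over the end of the path. *)
Lemma covering_surjective (B A : graph_of_groups) (mu : morphism B A) (u : A) :
  covering mu -> inhabited B -> connected A -> exists v, mu v = u.
Proof.
move=> cov [v] /connected_apath conn; have [p] := conn (mu v) u.
move: (pact (fpoint cov 1) p) => y {p}; move: u y.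
by apply: (fiber_ind (cov := cov)) => w _; exists w.
Qed.

(** * Classification of coverings *)

Lemma pointed_covering_iso (A : graph_of_groups) (u0 : A)
    (c d : pointed_covering u0) :
  pcov_iso c d <-> pcov_subgroup c = pcov_subgroup d.
Proof.
case: c d => [B v0 connB mu mu_v0 cov_mu] [C w0 connC nu nu_w0 cov_nu].
rewrite /pcov_iso /pcov_subgroup /=; split.
  move=> [phi [psi [[Ephi Epsi]
    [/pmor_equivE [c Ec _] _ /pmor_equivE [a Ea a1]]]]].
  have [g [-> /(_ a1) ->]] := iso_pi1_image mu_v0 nu_w0 Ec Ea Ephi Epsi.
  exact: conj_set1.
rewrite (pi1_imageE cov_mu) (pi1_imageE cov_nu) => E.
have [F [G [Feq Geq GF FG Fbase]]] := equivariant_iso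
  (fbase_transitive mu_v0 connB) (fbase_transitive nu_w0 connC) E.
have [phi [psi [a [c [d [Ec Ed Ea base]]]]]] := covering_iso Feq Geq GF FG.
have [] := base v0 w0.
  rewrite -(fbaseE cov_nu nu_w0) -Fbase.
  exact: esym (congr1 (fun s : {u : A & fiber cov_mu u} =>
    existT (fiber cov_nu) (projT1 s) (F _ (projT2 s))) (fbaseE cov_mu mu_v0)).
move=> Ephi Epsi a1 c1 d1; exists phi, psi; split=> //.
by split; apply/pmor_equivE; [exists c|exists d|exists a].
Qed.

(** For the converse implication, a conjugate of the group of [d] at [w0] is
    the stabiliser of another point of the same fibre, which need not be a
    base point: the equivariant bijection ignores the difference. *)
Lemma connected_covering_iso (A : graph_of_groups) (u0 : A)
    (c d : connected_covering A) (C D : set (set (pi1 u0))) :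
  cov_class c C -> cov_class d D -> cov_iso c d <-> C = D.
Proof.
case: c d => [B connB mu cov_mu] [B' connB' nu cov_nu].
rewrite /cov_class /cov_iso /= => -[v0 [mu_v0 ->]] [w0 [nu_w0 ->]]; split.
  move=> [phi [psi [/mor_equivE [c Ec] /mor_equivE [d Ed] /mor_equivE [a Ea]]]].
  have nu_phi : nu (phi v0) = u0.
    exact: etrans (esym (equiv_via_vertex v0 Ea)) mu_v0.
  have psi_phi : psi (phi v0) = v0 := esym (equiv_via_vertex v0 Ed).
  have [g [-> _]] := iso_pi1_image mu_v0 nu_phi Ec Ea erefl psi_phi.
  by rewrite conj_class_conj; apply: pi1_image_vertex.
move/conj_class_eq => [g]; rewrite (pi1_imageE cov_mu) (pi1_imageE cov_nu).
rewrite -[g]reprK -stabiliser_pact => E.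
have trans : transitive_from (pact (fbase cov_nu nu_w0) (repr g)).
  move=> v z; have [p ->] := fbase_transitive nu_w0 connB' z.
  by exists (pcat (pinv (repr g)) p); rewrite pact_cat pact_pinvK.
have [F [G [Feq Geq GF FG _]]] := equivariant_iso
  (fbase_transitive mu_v0 connB) trans E.
have [phi [psi [a [c [d [Ec Ed Ea _]]]]]] := covering_iso Feq Geq GF FG.
exists phi, psi; split; apply/mor_equivE.
- by exists c.
- by exists d.
- by exists a.
Qed.

Theorem theorem4p13 (A : graph_of_groups) (u0 : A) :
  induces_bijection (@pcov_iso A u0) (@subgroup (pi1 u0))
    (fun c H => H = pcov_subgroup c) /\
  (connected A ->
   induces_bijection (@cov_iso A) (@subgroup_classes (pi1 u0))
     (fun c C => cov_class c C)).
Proof.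
split=> [|connA]; split.
- by move=> c; exists (pcov_subgroup c); split.
- by move=> c H ->; apply/pi1_image_subgroup/pc_covering.
- by move=> c d H K -> ->; apply: pointed_covering_iso.
- by move=> H /subgroup_covering [c <-]; exists c.
- move=> c; have [v0 mu_v0] := covering_surjective u0 (cc_covering c)
    (proj1 (cc_connected c)) connA.
  exists (conj_class (pi1_image mu_v0)); split; first by exists v0, mu_v0.
  move=> _ [w0 [nu_w0 ->]].
  exact: pi1_image_vertex (cc_covering c) (cc_connected c).
- move=> c _ [v0 [mu_v0 ->]]; exists (pi1_image mu_v0) => //.
  exact: pi1_image_subgroup (cc_covering c).
- by move=> c d C D; apply: connected_covering_iso.
- move=> _ [H subH <-]; have [c <-] := subgroup_covering subH.
  exists (ConnectedCovering (pc_connected c) (pc_covering c)).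
  by exists (pc_base c), (pc_pointed c).
Qed.
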